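(* A polynomial is singular (in terms of factorization) if and only if its factorization structure is nontrivial. Moreover, for every $\ell$-tuple degree $\mathbf{m}$, the nonsingular polynomials of degree $\mathbf{m}$ form an open dense subset of $\mathbb{P}^{\mathbf{m}}$.
   Context: For nonzero $f\in\mathbb{C}[x_1,\ldots,x_\ell]$, $\deg(f)=(\deg_{x_1}f,\ldots,\deg_{x_\ell}f)$. $\mathbb{P}^{\mathbf{n}}$ is the vector space of polynomials of degree $\le\mathbf{n}$ (componentwise), $\langle\mathbf{n}\rangle=\dim\mathbb{P}^{\mathbf{n}}$, $\mathscr{P}^{\mathbf{n}}$ is the set of polynomials of degree exactly $\mathbf{n}$; $\mathbb{P}^{\mathbf{n}}$ is topologized by the Euclidean norm of the coefficient vector. If $f$ has degree $\mathbf{m}$ and $f=\alpha f_1^{k_1}\cdots f_r^{k_r}$ with $\alpha\in\mathbb{C}\setminus\{0\}$, $f_j$ irreducible and pairwise coprime, $k_j\ge1$, $\mathbf{m}_j=\deg(f_j)$, then the factorization structure of $f$ is the formal product $\mathfrak{M}=\mathbf{m}_1^{k_1}\cdots\mathbf{m}_r^{k_r}$ (order irrelevant). $\mathscr{F}^{\mathfrak{M}}$ is the set of all $f\in\mathscr{P}^{\mathbf{m}}$ of the form $\alpha g_1^{k_1}\cdots g_r^{k_r}$ with $\alpha\in\mathbb{C}$ and $g_j\in\mathscr{P}^{\mathbf{m}_j}$ irreducible and pairwise coprime. It is a complex analytic manifold in $\mathbb{P}^{\mathbf{m}}$ of codimension $\mathrm{codim}(\mathscr{F}^{\mathfrak{M}})=\langle\mathbf{m}\rangle-(\langle\mathbf{m}_1\rangle+\cdots+\langle\mathbf{m}_r\rangle+1-r)$.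 A factorization structure is trivial if it is the factorization structure of either an irreducible polynomial or a univariate polynomial (one depending on a single variable) with no multiple roots; otherwise it is nontrivial. The singularity of a polynomial of degree $\mathbf{m}$ with factorization structure $\mathfrak{M}$ is the codimension of $\mathscr{F}^{\mathfrak{M}}$ in $\mathbb{P}^{\mathbf{m}}$; the polynomial is singular if its singularity is positive, and nonsingular otherwise. *)

(* Defs.v *)
From HB Require Import structures.
From mathcomp Require Import all_boot all_order all_algebra.
From mathcomp Require Import reals complex mpoly.

Set Implicit Arguments.
Unset Strict Implicit.
Unset Printing Implicit Defensive.

Import GRing.Theory Num.Theory.

Local Open Scope ring_scope.

(* The field C of complex numbers is [R[i]] for [R : realType]. *)
Definition cpoly (R : realType) (l : nat) : Type := {mpoly R[i][l]}.
Definition multidegree (l : nat) : Type := 'X_{1..l}.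

(* The componentwise degree; only meaningful for f != 0. *)
Definition multideg (R : realType) (l : nat) (f : {mpoly R[i][l]}) :
    'X_{1..l} :=
  [multinom \max_(mu <- msupp f) (mu i : nat) | i < l].

Section BoundedDegree.
Variables (R : realType) (l : nat).
Implicit Types (m : 'X_{1..l}) (f g : {mpoly R[i][l]}).

(* Membership in P^m; for f != 0 this says multideg f <= m (leqmP below). *)
Definition leqm m : pred {mpoly R[i][l]} :=
  fun f => all (fun mu : 'X_{1..l} => (mu <= m)%MM) (msupp f).

Lemma leqm_coeffP m f :
  reflect (forall mu, ~~ (mu <= m)%MM -> f@_mu = 0) (leqm m f).
Proof.
apply: (iffP allP) => h mu.
  by move=> nle; apply/eqP; rewrite mcoeff_eq0; apply: contra nle; apply: h.
by move=> mu_f; apply: contraLR mu_f => /h /eqP; rewrite mcoeff_eq0.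
Qed.

Lemma leqmP m f : leqm m f = (f == 0) || (multideg f <= m)%MM.
Proof.
apply/allP/orP => [h|[/eqP-> mu|/mnm_lepP h mu mu_f]].
- by right; apply/mnm_lepP => i; rewrite mnmE;
    apply/bigmax_leqP_seq => mu mu_f _; exact: (mnm_lepP (h _ mu_f)).
- by rewrite msupp0.
- apply/mnm_lepP => i; apply: leq_trans (h i); rewrite mnmE.
  exact: (leq_bigmax_seq mu mu_f isT).
Qed.

Fact leqm_submod m : submod_closed (leqm m).
Proof.
split=> [|a f g]; first by rewrite unfold_in /leqm msupp0.
move=> /leqm_coeffP hf /leqm_coeffP hg; apply/leqm_coeffP => mu nle.
by rewrite mcoeffD mcoeffZ hf ?hg // mulr0 addr0.
Qed.

HB.instance Definition _ m :=
  GRing.isSubmodClosed.Build R[i] {mpoly R[i][l]} (leqm m) (leqm_submod m).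

(* The vector space P^m. *)
Record Pspace m := PSpace { poly_of_Pspace :> {mpoly R[i][l]};
                            _ : poly_of_Pspace \in leqm m }.

HB.instance Definition _ m := [isSub for @poly_of_Pspace m].
HB.instance Definition _ m := [Choice of Pspace m by <:].
HB.instance Definition _ m := [SubChoice_isSubLmodule of Pspace m by <:].

Definition monomle m : predArgType :=
  {mu : 'X_{1..l < (mdeg m).+1} | (bmnm mu <= m)%MM}.
HB.instance Definition _ m := Finite.on (monomle m).

Definition mle m (mu : monomle m) : 'X_{1..l} := bmnm (val mu).

Lemma mle_inj m : injective (@mle m).
Proof. by move=> mu nu /val_inj/val_inj. Qed.

Lemma mle_surj m mu : (mu <= m)%MM -> exists nu : monomle m, mle nu = mu.
Proof.
move=> le_mu; have lt_mu : (mdeg mu < (mdeg m).+1)%N.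
  by rewrite ltnS !mdegE; apply: leq_sum => i _; exact: (mnm_lepP le_mu).
by exists (exist _ (BMultinom lt_mu) le_mu).
Qed.

Lemma Pspace_vecaxiom m : Vector.axiom #|monomle m| (Pspace m).
Proof.
exists (fun f : Pspace m => \row_i (val f)@_(mle (enum_val i))).
  by move=> a f g; apply/rowP => i; rewrite !mxE /= mcoeffD mcoeffZ.
pose G (r : 'rV[R[i]]_#|monomle m|) : {mpoly R[i][l]} :=
  \sum_i r 0 i *: 'X_[mle (enum_val i)].
have GP r : G r \in leqm m.
  apply: rpred_sum => i _; apply: rpredZ; apply/leqm_coeffP => mu.
  rewrite mcoeffX; case: eqP => // <- /negP[].
  exact: (valP (enum_val i)).
have GE r (nu : monomle m) : (G r)@_(mle nu) = r 0 (enum_rank nu).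
  rewrite /G raddf_sum (bigD1 (enum_rank nu)) //= mcoeffZ mcoeffX.
  rewrite enum_rankK eqxx mulr1 big1 ?addr0 // => i ne.
  rewrite mcoeffZ mcoeffX (inj_eq (@mle_inj m)).
  by rewrite -(inj_eq enum_rank_inj) enum_valK (negbTE ne) mulr0.
exists (fun r => PSpace (GP r)) => [f|r]; last first.
  by apply/rowP => i; rewrite mxE /= GE enum_valK.
apply/val_inj/mpolyP => mu /=.
have [/mle_surj[nu <-]|nle] := boolP (mu <= m)%MM.
  by rewrite GE mxE enum_rankK.
by rewrite (leqm_coeffP _ _ (GP _)) // (leqm_coeffP _ _ (valP f)).
Qed.

HB.instance Definition _ m :=
  Lmodule_hasFinDim.Build R[i] (Pspace m) (Pspace_vecaxiom m).

End BoundedDegree.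

(* <m> = dim P^m *)
Definition pdim (R : realType) (l : nat) (m : multidegree l) : nat :=
  \dim {: Pspace R m}.

Section Factorization.
Variables (R : realType) (l : nat).
Implicit Types (f g : cpoly R l) (m : multidegree l).

(* script P^m: the polynomials of degree exactly m *)
Definition has_multideg m f : Prop := f != 0 /\ multideg f = m.

Definition dvd_mpoly g f : Prop := exists q, f = g * q.

Definition irreducible_mpoly f : Prop :=
  [/\ f != 0, f \isn't a GRing.unit &
      forall g h, f = g * h -> g \is a GRing.unit \/ h \is a GRing.unit].

Definition coprime_mpoly f g : Prop :=
  forall d, dvd_mpoly d f -> dvd_mpoly d g -> d \is a GRing.unit.

(* The formal product m_1^k_1 ... m_r^k_r, as the list of the pairs (m_j, k_j);
   all the notions below are invariant under permutation of the list. The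
   empty list is the structure of the nonzero constants. *)
Definition fstructure : Type := seq (multidegree l * nat).

(* "M is the factorization structure of f", i.e. f belongs to F^M. *)
Definition has_fstructure f (M : fstructure) : Prop :=
  exists (a : R[i]) (r : nat) (g : 'I_r -> cpoly R l) (k : 'I_r -> nat),
    [/\ a != 0,
        f = a *: \prod_(j < r) g j ^+ k j,
        forall j, irreducible_mpoly (g j) /\ (0 < k j)%N,
        forall i j, i != j -> coprime_mpoly (g i) (g j) &
        perm_eq M [seq (multideg (g j), k j) | j <- enum 'I_r]].

(* Codimension in P^m of the complex analytic manifold
   F^M = {f | has_fstructure f M}, where M consists of the factors of a
   polynomial of degree m:
   <m> - (<m_1> + ... + <m_r> + 1 - r). *)
Definition fcodim m (M : fstructure) : int :=
  (pdim R m)%:Z - (\sum_(p <- M) (pdim R p.1)%:Z + 1 - (size M)%:Z).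

Definition singularity f (d : int) : Prop :=
  exists2 M, has_fstructure f M & d = fcodim (multideg f) M.

Definition singular f : Prop := exists2 d, singularity f d & 0 < d.

Definition nonsingular f : Prop := ~ singular f.

(* f lies in C[x_i]; constants are included. *)
Definition univariate_in (i : 'I_l) f : Prop :=
  forall j, j != i -> multideg f j = 0%N.

Definition multiple_root (i : 'I_l) f (c : R[i]) : Prop :=
  dvd_mpoly (('X_i - c%:MP) ^+ 2) f.

Definition trivial_fstructure (M : fstructure) : Prop :=
  exists2 g, has_fstructure g M &
    irreducible_mpoly g \/
    exists2 i, univariate_in i g & forall c, ~ multiple_root i g c.

Definition nontrivial_fstructure (M : fstructure) : Prop :=
  ~ trivial_fstructure M.

(* Euclidean norm of the coefficient vector *)
Definition coef_norm f : R :=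
  Num.sqrt (\sum_(mu <- msupp f) ComplexField.Normc.normc f@_mu ^+ 2).

(* Open, resp. dense, in P^m for the distance coef_norm (f - g). *)
Definition open_in_P m (U : cpoly R l -> Prop) : Prop :=
  (forall f, U f -> f \in leqm m) /\
  forall f, U f -> exists2 e : R, 0 < e &
    forall g, g \in leqm m -> coef_norm (g - f) < e -> U g.

Definition dense_in_P m (U : cpoly R l -> Prop) : Prop :=
  (forall f, U f -> f \in leqm m) /\
  forall f, f \in leqm m -> forall e : R, 0 < e ->
    exists2 g, U g & coef_norm (g - f) < e.

Definition nonsingular_of_multideg m f : Prop :=
  has_multideg m f /\ nonsingular f.

End Factorization.

(* Main.v *)
From HB Require Import structures.
Require Import Defs.
From mathcomp Require Import all_boot all_order all_algebra.
From mathcomp Require Import reals complex mpoly.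
From mathcomp Require Import zify ring lra.
From mathcomp Require boolp classical_sets topology normedtype derive.

(** Write N(m) = <m> - 1. The codimension attached to a structure with factors
    of degrees m_j is N(m) - sum_j N(m_j), where m = sum_j k_j m_j. The function
    N is superadditive, and for nonzero a and b one has N(a + b) = N(a) + N(b)
    exactly when a and b are concentrated on one and the same variable. Hence
    the codimension is never negative, and it vanishes only if all exponents are
    1 and there is at most one factor, or all factors are polynomials in the
    same variable; distinct irreducible factors exclude double roots. This is
    triviality of the polynomial itself ([trivial_poly]), a condition in which
    the chosen factorization no longer appears ([fcodim_trivial]); with the
    existence of factorizations, a nonzero polynomial is nonsingular if and only
    if it is trivial ([nonsingularP]).

    For the topological part, a nonzero polynomial f of degree m is nontrivial
    if and only if f = g^s h with deg g <= a, deg h <= b, m = s a + b, s in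
    {1, 2} and <a> + <b> - 1 < <m> ([nontrivial_split], [split_nontrivial]): a
    proper factorization with s = 1 works unless only one variable occurs, and
    then a double root provides s = 2. For each of the finitely many (s, a, b)
    let V be the set of these products. Normalizing in each factor a coefficient
    of largest modulus to 1 shows that V consists of the multiples c P(z) of
    finitely many polynomial families P, never zero, with parameters z in a
    compact polydisc of dimension <a> + <b> - 2 ([chart_cover]).

    Density: c and z are fewer than <m> parameters, so the coefficients of
    c P(z) satisfy a nontrivial polynomial relation, by counting monomials
    ([homogeneous_dependence]). The product of these relations and of the
    coefficient of x^m is a nonzero polynomial Q on the coefficient space; where
    it does not vanish there are only nonsingular polynomials of degree m, and
    any point can be moved slightly to make Q nonzero ([nonvanishing_near]).

    Openness: if f is not in V, it is not proportional to any P(z), so the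
    2x2 minors of the coefficients of f and P(z) have no common zero z. By
    compactness the sum of their squared moduli has a positive minimum, whereas
    an element c P(z) of V close to f would make all of them small
    ([chart_separated]). *)

Set Implicit Arguments.
Unset Strict Implicit.
Unset Printing Implicit Defensive.

Import Order.TTheory GRing.Theory Num.Theory.

Local Open Scope ring_scope.

(** * Additivity of the multidegree *)

Lemma mul_exp_neq0 (A : idomainType) (x y : A) (s : nat) :
  (0 < s)%N -> x ^+ s * y != 0 -> x != 0 /\ y != 0.
Proof. by move=> s_gt0; rewrite mulf_eq0 negb_or expf_eq0 s_gt0 => /andP[]. Qed.

Lemma size_mul_succ (A : idomainType) (p q : {poly A}) (c d : nat) :
  size p = c.+1 -> size q = d.+1 -> size (p * q) = (c + d).+1.
Proof.
move=> Ep Eq; rewrite size_mul -?size_poly_eq0 ?Ep ?Eq //.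
by rewrite addSn addnS.
Qed.

Section Multidegree.
Variables (R : realType) (l : nat).
Implicit Types (f g h : {mpoly R[i][l]}) (m mu nu a b : 'X_{1..l}) (i j : 'I_l).

Lemma multideg_ge f mu : mu \in msupp f -> (mu <= multideg f)%MM.
Proof.
move=> fmu; apply/mnm_lepP => i; rewrite mnmE.
exact: (leq_bigmax_seq mu fmu isT).
Qed.

Lemma multideg_attained f i :
  f != 0 -> exists2 mu, mu \in msupp f & mu i = multideg f i.
Proof.
rewrite -msupp_eq0 mnmE; elim: (msupp f) => // mu s IHs _.
rewrite big_cons; case: leqP => le; last by exists mu; rewrite ?mem_head.
case: s IHs le => [|nu s] IHs le.
  by exists mu; [rewrite mem_head | rewrite big_nil in le *; apply/eqP; rewrite -leqn0].
by have [//|x xs ex] := IHs; exists x => //; rewrite in_cons xs orbT.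
Qed.

Lemma leqm_multideg f m : f \in leqm m -> f != 0 -> (multideg f <= m)%MM.
Proof. by rewrite -[_ \in _]/(leqm m f) leqmP => /orP[->|]. Qed.

Lemma multideg_leqm f m : (multideg f <= m)%MM -> f \in leqm m.
Proof. by move=> le; rewrite -[_ \in _]/(leqm m f) leqmP le orbT. Qed.

(** Makes the degree in [x_i] the degree of a univariate polynomial, which is
    known to be additive: each monomial is multiplied by the power of a new
    variable given by its [i]-th exponent. *)
Definition grade i : {mpoly R[i][l]} -> {poly {mpoly R[i][l]}} :=
  mmap (fun c => (c%:MP)%:P) (fun j => ('X_j)%:P * 'X ^+ (i == j)).

Lemma gradeM i : {morph grade i : f g / f * g}.
Proof.
pose h : {rmorphism R[i] -> {poly {mpoly R[i][l]}}} := polyC \o (@mpolyC l R[i]).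
by move=> f g; rewrite /grade -[fun c => _]/(h : _ -> _) rmorphM.
Qed.

Lemma gradeE i f d mu : ((grade i f)`_d)@_mu = f@_mu *+ (d == mu i).
Proof.
have E nu : mmap1 (fun j => ('X_j)%:P * 'X ^+ (i == j)) nu =
    ('X_[nu] : {mpoly R[i][l]})%:P * 'X ^+ (nu i).
  rewrite /mmap1 (eq_bigr (fun j => ('X_j ^+ nu j)%:P * 'X ^+ ((i == j) * nu j))).
    rewrite big_split /= -rmorph_prod -mpolyXE_id; congr (_ * _).
    rewrite (bigD1 i) //= eqxx mul1n big1 ?mulr1 // => j /negbTE.
    by rewrite eq_sym => ->; rewrite mul0n.
  by move=> j _; rewrite exprMn rmorphXn -exprM.
rewrite /grade /mmap coef_sum raddf_sum /=.
rewrite [in RHS](mpolyE f) raddf_sum /= -sumrMnl; apply: eq_bigr => nu _.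
rewrite E mulrA -polyCM coefCM coefXn mulr_natr mcoeffMn mcoeffCM mcoeffZ mcoeffX.
by case: eqP => [->|_]; rewrite ?mulr0 ?mul0rn.
Qed.

Lemma size_grade i f : f != 0 -> size (grade i f) = (multideg f i).+1.
Proof.
move=> nz; apply/eqP; rewrite eqn_leq; apply/andP; split.
  apply/leq_sizeP => d ld; apply/mpolyP => mu; rewrite gradeE mcoeff0.
  case: eqP => // E; have [/multideg_ge/mnm_lepP/(_ i)|/memN_msupp_eq0->//] :=
    boolP (mu \in msupp f).
  by rewrite -E leqNgt ld.
have [mu mu_f E] := multideg_attained i nz.
rewrite ltnNge; apply/negP => /leq_sizeP/(_ _ (leqnn _)) /mpolyP/(_ mu).
rewrite gradeE E eqxx mcoeff0 => /eqP; rewrite mulr1n.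
by rewrite mcoeff_eq0 mu_f.
Qed.

Lemma multidegM f g :
  f != 0 -> g != 0 -> multideg (f * g) = (multideg f + multideg g)%MM.
Proof.
move=> nf ng; have nfg : f * g != 0 by exact: mulf_neq0.
apply/mnmP => i; rewrite mnmDE; apply: succn_inj.
rewrite -(size_grade i nfg) gradeM.
exact: size_mul_succ (size_grade i nf) (size_grade i ng).
Qed.

Lemma multidegC (c : R[i]) : multideg (c%:MP_[l]) = 0%MM.
Proof.
apply/mnmP => i; rewrite mnmE mnm0E msuppC; case: eqP => _; first exact: big_nil.
by rewrite big_seq1 mnm0E.
Qed.

Lemma multidegX f k : f != 0 -> multideg (f ^+ k) = (multideg f *+ k)%MM.
Proof.
move=> nf; elim: k => [|k IHk]; first by rewrite expr0 mulm0n -mpolyC1 multidegC.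
by rewrite exprS multidegM ?expf_neq0 // IHk mulmS.
Qed.

Lemma multidegZ (c : R[i]) f : c != 0 -> multideg (c *: f) = multideg f.
Proof.
move=> nc; have [->|nf] := eqVneq f 0; first by rewrite scaler0.
by rewrite -mul_mpolyC multidegM ?mpolyC_eq0 // multidegC add0m.
Qed.

Lemma multideg_prod (I : Type) (r : seq I) (F : I -> {mpoly R[i][l]}) :
  (forall x, F x != 0) ->
  multideg (\prod_(x <- r) F x) = (\sum_(x <- r) multideg (F x))%MM.
Proof.
move=> nF; elim: r => [|x r IHr].
  by rewrite !big_nil -mpolyC1 multidegC.
rewrite !big_cons multidegM ?IHr //.
by elim/big_ind: _ => //; [exact: oner_neq0 | exact: mulf_neq0].
Qed.

Lemma multideg_eq0 f : multideg f = 0%MM -> f = (f@_0%MM)%:MP.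
Proof.
move=> d0; apply/mpolyP => mu; rewrite mcoeffC.
have [->|nz] := eqVneq mu 0%MM; first by rewrite mulr1.
rewrite mulr0; apply: memN_msupp_eq0; apply: contra nz => /multideg_ge.
rewrite d0 => /mnm_lepP le0; apply/eqP/mnmP => i; rewrite mnm0E.
by have := le0 i; rewrite mnm0E leqn0 => /eqP.
Qed.

Lemma unit_multideg f : (f \is a GRing.unit) = (f != 0) && (multideg f == 0%MM).
Proof.
apply/idP/andP => [Uf|[nf /eqP d0]].
  have nf : f != 0 by apply: contraTneq Uf => ->; rewrite unitr0.
  split=> //; have /eqP := congr1 (@multideg _ _) (divrr Uf).
  rewrite multidegM ?invr_eq0 // -mpolyC1 multidegC mnmD_eq0.
  by case/andP.
rewrite (multideg_eq0 d0) in nf *; move: nf; rewrite mpolyC_eq0 => nf.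
by apply: (rmorph_unit (@mpolyC l R[i])); rewrite unitfE.
Qed.

Lemma leqmM f g a b : f \in leqm a -> g \in leqm b -> f * g \in leqm (a + b)%MM.
Proof.
have [->|nf] := eqVneq f 0; first by move=> _ _; rewrite mul0r rpred0.
have [->|ng] := eqVneq g 0; first by move=> _ _; rewrite mulr0 rpred0.
move=> /leqm_multideg/(_ nf)/mnm_lepP fa /leqm_multideg/(_ ng)/mnm_lepP gb.
apply: multideg_leqm; rewrite multidegM //; apply/mnm_lepP => i.
by rewrite !mnmDE leq_add.
Qed.

Lemma leqmX f a k : f \in leqm a -> f ^+ k \in leqm (a *+ k)%MM.
Proof.
move=> fa; elim: k => [|k IHk]; last by rewrite exprS mulmS leqmM.
by rewrite mulm0n expr0 -mpolyC1; apply: multideg_leqm; rewrite multidegC lepm_refl.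
Qed.

End Multidegree.

(** * Superadditivity of the dimension *)

Section Dimension.
Variable l : nat.
Implicit Types (m a b : 'X_{1..l}) (i j : 'I_l).

Lemma pdimE (R : realType) m : pdim R m = #|monomle m|.
Proof. exact: dimvf. Qed.

Lemma mle_le m (mu : monomle m) : (mle mu <= m)%MM.
Proof. exact: (valP mu). Qed.

Fact monom_lt m mu : (mu <= m)%MM -> (mdeg mu < (mdeg m).+1)%N.
Proof.
by move=> le; rewrite ltnS !mdegE; apply: leq_sum => i _; apply: (mnm_lepP le).
Qed.

Definition monom m mu (le : (mu <= m)%MM) : monomle m :=
  exist _ (BMultinom (monom_lt le)) le.

Lemma monomK m mu (le : (mu <= m)%MM) : mle (monom le) = mu. Proof. by []. Qed.

Lemma card_monomle0 : #|monomle (0%MM : 'X_{1..l})| = 1%N.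
Proof.
apply/eqP/fintype1P; exists (monom (lepm_refl 0%MM)) => mu.
apply: mle_inj; rewrite monomK; apply/mnmP => i; rewrite mnm0E.
by have /mnm_lepP/(_ i) := mle_le mu; rewrite mnm0E leqn0 => /eqP.
Qed.

Lemma lem_addm a b c d :
  (a <= c)%MM -> (b <= d)%MM -> ((a + b) <= (c + d))%MM.
Proof.
move=> /mnm_lepP ac /mnm_lepP bd; apply/mnm_lepP => i.
by rewrite !mnmDE leq_add.
Qed.

Let lowbox a b (mu : monomle a) : monomle (a + b)%MM :=
  monom (lepm_trans (mle_le mu) (lem_addr a b)).
Let highbox a b (mu : monomle b) : monomle (a + b)%MM :=
  monom (lem_addm (lepm_refl a) (mle_le mu)).

Let lowbox_inj a b : injective (@lowbox a b).
Proof. by move=> mu nu /(congr1 (@mle _ _)) E; apply: mle_inj; exact: E. Qed.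

Let highbox_inj a b : injective (@highbox a b).
Proof. by move=> mu nu /(congr1 (@mle _ _)) /addmI E; apply: mle_inj; exact: E. Qed.

Let boxesI a b :
  (#|[set lowbox b mu | mu in {: monomle a}] :&:
     [set highbox a mu | mu in {: monomle b}]| <= 1)%N.
Proof.
rewrite -(cards1 (lowbox b (monom (lepm_refl a)))) subset_leq_card //.
apply/subsetP => x /setIP[/imsetP[mu _ ->] /imsetP[nu _ E]].
rewrite inE; apply/eqP/mle_inj; rewrite monomK.
move/(congr1 (@mle _ _)): E; rewrite !monomK => E; rewrite E.
apply/mnmP => i; have /mnm_lepP/(_ i) := mle_le mu.
by rewrite E mnmDE; lia.
Qed.

(** The monomials dividing [x^(a+b)] contain those dividing [x^a] and the
    [x^a]-multiples of those dividing [x^b]; only [x^a] belongs to both. *)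
Lemma card_monomleD a b :
  (#|monomle a| + #|monomle b| <= #|monomle (a + b)%MM|.+1)%N.
Proof.
rewrite -(card_imset _ (@lowbox_inj a b)) -(card_imset _ (@highbox_inj a b)).
rewrite -cardsUI -addn1 leq_add ?boxesI //; exact: max_card.
Qed.

(** If [x_i] occurs in [x^a] and [x_j] in [x^b], then the power of [x_j] with
    exponent [a_j + b_j] avoids both families of monomials. *)
Lemma card_monomleD_strict a b i j :
  i != j -> (0 < a i)%N -> (0 < b j)%N ->
  (#|monomle a| + #|monomle b| <= #|monomle (a + b)%MM|)%N.
Proof.
move=> ij ai bj; pose w := [multinom if k == j then (a j + b j)%N else 0%N | k < l].
have le_w : (w <= a + b)%MM.
  by apply/mnm_lepP => k; rewrite mnmE mnmDE; case: eqP => // ->.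
rewrite -(card_imset _ (@lowbox_inj a b)) -(card_imset _ (@highbox_inj a b)).
rewrite -cardsUI -[X in (_ <= X)%N]cardsT (cardsD1 (monom le_w) setT) inE add1n -addn1.
rewrite leq_add ?boxesI //; apply: subset_leq_card.
apply/subsetP => x xU; rewrite !inE andbT; apply: contraTneq xU => ->.
rewrite inE; apply/norP; split; apply/imsetP => -[mu _ /(congr1 (@mle _ _))];
  rewrite !monomK => E.
  have /mnm_lepP/(_ j) := mle_le mu; rewrite -E mnmE eqxx; lia.
by have := congr1 (fun m : 'X_{1..l} => m i) E; rewrite /= mnmE mnmDE (negbTE ij); lia.
Qed.

Lemma card_monomle_uni m i :
  (forall j, j != i -> m j = 0%N) -> #|monomle m| = (m i).+1.
Proof.
move=> uni; rewrite -[RHS]card_ord.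
have lt_mu (mu : monomle m) : (mle mu i < (m i).+1)%N.
  by rewrite ltnS; apply: (mnm_lepP (mle_le mu)).
apply: (@bij_eq_card _ _ (fun mu => Ordinal (lt_mu mu))).
have le_k (k : 'I_(m i).+1) : (U_(i) *+ k <= m)%MM.
  apply/mnm_lepP => j; rewrite mulmnE mnm1E; case: eqP => [<-|_]; last by rewrite mul0n.
  by rewrite mul1n -ltnS.
exists (fun k => monom (le_k k)) => [mu|k].
  apply: mle_inj; apply/mnmP => j; rewrite monomK mulmnE mnm1E /=.
  case: eqP => [<-|/eqP ne]; first by rewrite mul1n.
  have /mnm_lepP/(_ j) := mle_le mu; rewrite uni 1?eq_sym // leqn0 => /eqP->.
  by rewrite mul0n.
by apply: val_inj; rewrite /= monomK mulmnE mnm1E eqxx mul1n.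
Qed.

Lemma card_monomle_gt0 m : (0 < #|monomle m|)%N.
Proof. by apply/card_gt0P; exists (monom (lepm_refl m)). Qed.

Lemma card_monomle_gt1 m : m != 0%MM -> (1 < #|monomle m|)%N.
Proof.
move=> nz; have le0 : (0 <= m)%MM.
  by apply/mnm_lepP => i; rewrite mnm0E.
apply/card_gt1P; exists (monom le0), (monom (lepm_refl m)); split=> //.
by apply: contraNneq nz => /(congr1 (@mle _ _)); rewrite !monomK => <-.
Qed.

Lemma mnm_neq0P m : reflect (exists i, (0 < m i)%N) (m != 0%MM).
Proof.
apply: (iffP idP) => [nz|[i mi]]; last by apply: contraTneq mi => ->; rewrite mnm0E.
apply/existsP; apply: contraNT nz; rewrite negb_exists => /forallP m0.
by apply/eqP/mnmP => i; rewrite mnm0E; have := m0 i; lia.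
Qed.

(** If a variable of [x^a] differed from a variable of [x^b], the previous
    bound would apply; so all of them coincide. *)
Lemma card_monomleD_eq a b :
  a != 0%MM -> b != 0%MM -> (#|monomle (a + b)%MM| < #|monomle a| + #|monomle b|)%N ->
  exists i, forall j, j != i -> (a + b)%MM j = 0%N.
Proof.
move=> /mnm_neq0P[i ai] /mnm_neq0P[j0 bj0] lt.
have supp_b j : (0 < b j)%N -> j = i.
  move=> bj; apply/eqP; apply: contraTT lt; rewrite eq_sym -leqNgt => ij.
  exact: card_monomleD_strict ij ai bj.
exists i => j ne; rewrite mnmDE.
have -> : b j = 0%N by apply/eqP; rewrite -leqn0 leqNgt; apply: contra ne => /supp_b->.
have bi : (0 < b i)%N by rewrite -(supp_b _ bj0).
rewrite addn0; apply/eqP; rewrite -leqn0 leqNgt; apply: contraTN lt => aj.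
by rewrite -leqNgt; apply: card_monomleD_strict ne aj bi.
Qed.

Lemma card_monomle_Mn a k : (0 < k)%N ->
  (k * #|monomle a|.-1 <= #|monomle (a *+ k)%MM|.-1)%N.
Proof.
elim: k => // -[_ _|k IHk _]; first by rewrite mul1n mulm1n.
have := IHk isT; rewrite [(_ *+ k.+2)%MM]mulmS mulSn.
have := card_monomleD a (a *+ k.+1)%MM.
by have := card_monomle_gt0 a; have := card_monomle_gt0 (a *+ k.+1)%MM; lia.
Qed.

End Dimension.

(** * Linear factors *)

Section LinearFactor.
Variables (R : realType) (l : nat) (i : 'I_l) (c : R[i]).
Implicit Types (f g : cpoly R l).

(** Substitution of [c] for [x_i]. Its kernel is the ideal generated by
    [x_i - c], which is therefore prime. *)
Definition specialize : cpoly R l -> cpoly R l :=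
  mmap (@mpolyC l R[i]) (fun j => if j == i then c%:MP else 'X_j).

HB.instance Definition _ := GRing.RMorphism.on specialize.

Lemma specializeC a : specialize a%:MP = a%:MP.
Proof. exact: mmapC. Qed.

Lemma specializeU j : specialize 'X_j = if j == i then c%:MP else 'X_j.
Proof. by rewrite /specialize mmapX mmap1U. Qed.

(** Modulo [x_i - c] the substitution is a ring morphism that fixes the constants
    and the variables. *)
Lemma dvd_sub_specialize f : dvd_mpoly ('X_i - c%:MP) (f - specialize f).
Proof.
pose D f := dvd_mpoly ('X_i - c%:MP) (f - specialize f).
have DC a : D a%:MP by exists 0; rewrite specializeC subrr mulr0.
have DD g h : D g -> D h -> D (g + h).
  move=> [q Eq] [r Er]; exists (q + r).
  by rewrite rmorphD mulrDr -Eq -Er opprD addrACA.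
have DM g h : D g -> D h -> D (g * h).
  move=> [q Eq] [r Er]; exists (q * h + specialize g * r).
  by rewrite rmorphM mulrDr mulrA mulrCA -Eq -Er mulrBl mulrBr addrA subrK.
have DU j : D 'X_j.
  rewrite /D specializeU; case: eqP => [->|_]; first by exists 1; rewrite mulr1.
  by exists 0; rewrite subrr mulr0.
rewrite -/(D f) (mpolyE f).
apply: (big_ind D) => [||mu _]; [by rewrite -mpolyC0; exact: DC | exact: DD |].
rewrite -mul_mpolyC; apply: (DM); first exact: DC.
have D1 : D 1 by rewrite -mpolyC1; exact: DC.
rewrite mpolyXE_id; apply: (big_ind D) => [||j _]; [exact: D1 | exact: DM |].
elim: (mu j) => [|k IHk]; first by rewrite expr0; exact: D1.
by rewrite exprS; apply: (DM); [exact: DU | exact: IHk].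
Qed.

Lemma dvd_specialize f : dvd_mpoly ('X_i - c%:MP) f <-> specialize f = 0.
Proof.
split=> [[q ->]|f0]; last by have := dvd_sub_specialize f; rewrite f0 subr0.
by rewrite rmorphM rmorphB /= specializeU eqxx specializeC subrr mul0r.
Qed.

Lemma linear_prime f g : dvd_mpoly ('X_i - c%:MP) (f * g) ->
  dvd_mpoly ('X_i - c%:MP) f \/ dvd_mpoly ('X_i - c%:MP) g.
Proof.
move=> /dvd_specialize; rewrite rmorphM => /eqP; rewrite mulf_eq0.
by case/orP => /eqP E; [left | right]; apply/dvd_specialize.
Qed.

Lemma linear_neq0 : 'X_i - c%:MP != 0 :> cpoly R l.
Proof.
apply/eqP => /mpolyP/(_ U_(i)%MM) /eqP.
by rewrite mcoeffB mcoeffX mcoeffC mcoeff0 eqxx mnm1_eq0 mulr0 subr0 oner_eq0.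
Qed.

Lemma multideg_linear : multideg ('X_i - c%:MP : cpoly R l) = U_(i)%MM.
Proof.
apply/mnmP => j; apply/eqP; rewrite eqn_leq; apply/andP; split.
  rewrite mnmE; apply/bigmax_leqP_seq => mu /msuppB_le; rewrite mem_cat msuppX.
  rewrite mem_seq1 msuppC => /orP[/eqP-> //|]; case: (c == 0) => //.
  by rewrite mem_seq1 => /eqP-> _; rewrite mnm0E.
apply/mnm_lepP: j; apply: multideg_ge.
rewrite mcoeff_msupp mcoeffB mcoeffX mcoeffC eqxx mnm1_eq0 mulr0 subr0.
exact: oner_neq0.
Qed.

Lemma linear_nonunit : ('X_i - c%:MP : cpoly R l) \isn't a GRing.unit.
Proof. by rewrite unit_multideg multideg_linear mnm1_eq0 andbF. Qed.

End LinearFactor.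

Section UnivariateRoot.
Variables (R : realType) (l : nat).
Implicit Types (f g : cpoly R l).

(** The coefficients of [f] form a nonconstant polynomial in one variable over
    an algebraically closed field. *)
Lemma univariate_root f i : univariate_in i f -> multideg f != 0%MM ->
  exists c, dvd_mpoly ('X_i - c%:MP) f.
Proof.
move=> uni nz.
have supp_uni (mu : 'X_{1..l}) j : mu \in msupp f -> j != i -> mu j = 0%N.
  move=> /multideg_ge/mnm_lepP/(_ j) le ne; apply/eqP; rewrite -leqn0.
  by rewrite -(uni j ne).
have nf : f != 0.
  by apply: contraNneq nz => ->; rewrite -mpolyC0 multidegC.
pose p : {poly R[i]} := \sum_(mu <- msupp f) f@_mu *: 'X^(mu i).
have coef_p (mu : 'X_{1..l}) : mu \in msupp f -> p`_(mu i) = f@_mu.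
  move=> mu_f; rewrite coef_sum (bigD1_seq mu) ?msupp_uniq //=.
  rewrite coefZ coefXn eqxx mulr1 big_seq_cond big1 ?addr0 // => nu /andP[nu_f ne].
  rewrite coefZ coefXn; case: eqP => [E|_]; last by rewrite mulr0.
  case/eqP: ne; apply/mnmP => j; have [->//|ji] := eqVneq j i.
  by rewrite !supp_uni.
have [mu mu_f mu_i] := multideg_attained i nf.
have mu_gt0 : (0 < mu i)%N.
  rewrite mu_i lt0n; apply: contra nz => /eqP d0; apply/eqP/mnmP => j.
  by rewrite mnm0E; have [->//|/uni] := eqVneq j i.
have p_size : size p != 1%N.
  rewrite neq_ltn; apply/orP; right; apply: leq_ltn_trans mu_gt0 _.
  rewrite ltnNge; apply/negP => /leq_sizeP/(_ _ (leqnn _)) /eqP.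
  by rewrite coef_p // mcoeff_eq0 mu_f.
have [c /rootP pc] := closed_rootP p p_size; exists c.
apply/dvd_specialize; rewrite /specialize /mmap -[RHS](@mpolyC0 l) -pc.
rewrite horner_sum raddf_sum; apply: eq_big_seq => nu nu_f /=.
rewrite hornerZ hornerXn mpolyCM; congr (_ * _); rewrite /mmap1 (bigD1 i) //= eqxx.
rewrite big1 ?mulr1 ?rmorphXn // => j ji.
by rewrite (supp_uni nu) // expr0.
Qed.

End UnivariateRoot.

(** * Trivial polynomials and strict splittings *)

Section Triviality.
Variables (R : realType) (l : nat).
Hypothesis l_gt0 : (0 < l)%N.
Implicit Types (f g h : cpoly R l) (m a b : 'X_{1..l}) (i : 'I_l).

(** Triviality as a property of the polynomial instead of its structure: all
    structures of one polynomial have positive codimension, or none has. *)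
Definition trivial_poly f : Prop :=
  irreducible_mpoly f \/
  exists2 i, univariate_in i f & forall c, ~ multiple_root i f c.

(** The products [g ^+ s * h] with [deg g <= a] and [deg h <= b] depend on
    [<a> + <b> - 1] parameters, because the factors can be rescaled against each
    other; the inequality says that this is less than [<s a + b>]. *)
Definition strict_split (s : nat) a b : bool :=
  (#|monomle a| + #|monomle b| <= #|monomle (a *+ s + b)%MM|)%N.

Lemma dvd_unit g f : dvd_mpoly g f -> f \is a GRing.unit -> g \is a GRing.unit.
Proof. by move=> [q ->]; rewrite unitrM => /andP[]. Qed.

Lemma multideg_nonunit f : f != 0 -> f \isn't a GRing.unit -> multideg f != 0%MM.
Proof. by move=> nf; rewrite unit_multideg nf. Qed.

Lemma irreducible_multideg f : irreducible_mpoly f -> multideg f != 0%MM.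
Proof. by case=> nf nU _; exact: multideg_nonunit. Qed.

Lemma unit_trivial f : f \is a GRing.unit -> trivial_poly f.
Proof.
move=> Uf; right; exists (Ordinal l_gt0) => [j _|c [q Eq]].
  by move: Uf; rewrite unit_multideg => /andP[_ /eqP->]; rewrite mnm0E.
have /negP[] := linear_nonunit (Ordinal l_gt0) c.
by apply: dvd_unit Uf; exists (('X_(Ordinal l_gt0) - c%:MP) * q); rewrite Eq expr2 mulrA.
Qed.

Lemma reducible_factors f : f \isn't a GRing.unit -> f != 0 ->
  ~ irreducible_mpoly f ->
  exists g h, [/\ f = g * h, g \isn't a GRing.unit & h \isn't a GRing.unit].
Proof.
move=> nU nf red; apply: boolp.contrapT => no; apply: red; split=> // g h E.
have [Ug|nUg] := boolP (g \is a GRing.unit); first by left.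
have [Uh|nUh] := boolP (h \is a GRing.unit); first by right.
by case: no; exists g, h.
Qed.

(** Either the degrees of two proper factors split the degree strictly, or both
    factors involve the same single variable, and then a double root gives a
    strict splitting with the exponent 2. *)
Lemma nontrivial_split f : f != 0 -> ~ trivial_poly f ->
  exists s a b g h, [/\ s \in [:: 1%N; 2%N], strict_split s a b &
    [/\ multideg f = (a *+ s + b)%MM, f = g ^+ s * h, g \in leqm a & h \in leqm b]].
Proof.
move=> nf ntriv.
have nU : f \isn't a GRing.unit by apply/negP => /unit_trivial.
have [|g [h [E nUg nUh]]] := reducible_factors nU nf.
  by move=> irr; case: ntriv; left.
have /andP[ng nh] : (g != 0) && (h != 0) by rewrite -negb_or -mulf_eq0 -E.
have Em : multideg f = (multideg g + multideg h)%MM by rewrite E multidegM.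
case: (leqP (#|monomle (multideg g)| + #|monomle (multideg h)|)
            #|monomle (multideg g + multideg h)%MM|) => [strict|].
  exists 1%N, (multideg g), (multideg h), g, h; split=> //.
  by rewrite expr1; split=> //; apply: multideg_leqm; exact: lepm_refl.
case/card_monomleD_eq; rewrite ?multideg_nonunit // -Em => i uni.
have [c [q Eq]] : exists c, multiple_root i f c.
  apply: boolp.contrapT => no; case: ntriv; right; exists i => // c mr.
  by case: no; exists c.
have nq : q != 0 by apply: contraNneq nf => q0; rewrite Eq q0 mulr0.
have Emq : multideg f = (U_(i) *+ 2 + multideg q)%MM.
  rewrite Eq multidegM ?expf_neq0 ?linear_neq0 // multidegX ?linear_neq0 //.
  by rewrite multideg_linear.
exists 2%N, U_(i)%MM, (multideg q), ('X_i - c%:MP), q; split=> //.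
  rewrite /strict_split -Emq (card_monomle_uni uni).
  rewrite (@card_monomle_uni _ U_(i)%MM i); last first.
    by move=> j ji; rewrite mnm1E eq_sym (negbTE ji).
  rewrite (@card_monomle_uni _ (multideg q) i) => [|j ji].
    by rewrite Emq mnmDE mulmnE mnm1E eqxx; lia.
  by have := uni j ji; rewrite Emq mnmDE; lia.
by split=> //; apply: multideg_leqm; rewrite ?multideg_linear lepm_refl.
Qed.

(** The factors have the full degrees [a] and [b]. If one of them is constant the
    inequality fails; if a single variable occurs it forces [s >= 2] and a
    nonconstant [g], whose root is then a double root of the product. *)
Lemma split_nontrivial f g h s a b : f != 0 -> (0 < s)%N -> strict_split s a b ->
  multideg f = (a *+ s + b)%MM -> f = g ^+ s * h -> g \in leqm a -> h \in leqm b ->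
  ~ trivial_poly f.
Proof.
move=> nf s_gt0 strict Em E ga hb.
have [ng nh] : g != 0 /\ h != 0.
  by apply: mul_exp_neq0 s_gt0 _; rewrite -E.
have [Ea Eb] : multideg g = a /\ multideg h = b.
  have E1 i : ((multideg g i * s + multideg h i) = a i * s + b i)%N.
    have := congr1 (fun m : 'X_{1..l} => m i) Em.
    by rewrite E multidegM ?expf_neq0 // multidegX //= !mnmDE !mulmnE.
  have /mnm_lepP la := leqm_multideg ga ng.
  have /mnm_lepP lb := leqm_multideg hb nh.
  by split; apply/mnmP => i; have := E1 i; have := la i; have := lb i; nia.
have s_split : s = s.-1.+1 by rewrite prednK.
have a_split : (a *+ s + b = a + (a *+ s.-1 + b))%MM by rewrite {1}s_split mulmS addmA.
case=> [[_ _ irr]|[i uni nomult]].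
  have [||] := irr g (g ^+ s.-1 * h); first by rewrite mulrA -exprS -s_split.
    rewrite unit_multideg ng Ea => /eqP a0; move: strict.
    rewrite /strict_split a0 card_monomle0.
    have -> : ((0 : 'X_{1..l}) *+ s + b)%MM = b.
      by apply/mnmP => j; rewrite mnmDE mulmnE mnm0E mul0n.
    by rewrite ltnn.
  rewrite unit_multideg multidegM ?expf_neq0 // multidegX // Ea Eb => /andP[_ /eqP E0].
  move: strict; rewrite /strict_split a_split E0 addm0.
  by have := card_monomle_gt0 b; lia.
have ab_uni j : j != i -> a j = 0%N /\ b j = 0%N.
  by move=> /uni; rewrite Em mnmDE mulmnE; nia.
move: strict; rewrite /strict_split -Em (card_monomle_uni uni).
rewrite (@card_monomle_uni _ a i) => [|j /ab_uni[]//].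
rewrite (@card_monomle_uni _ b i) => [|j /ab_uni[]//].
rewrite Em mnmDE mulmnE => lt.
have [||c [q Eq]] := @univariate_root R l g i.
- by move=> j /ab_uni[<- _]; rewrite Ea.
- by rewrite Ea; apply/mnm_neq0P; exists i; nia.
have s_ge2 : s = s.-2.+2 by nia.
apply: (nomult c); exists (q ^+ 2 * (g ^+ s.-2 * h)).
by rewrite E {1}s_ge2 -addn2 addnC exprD -mulrA {1}Eq exprMn -mulrA.
Qed.

End Triviality.

(** * The codimension vanishes exactly on trivial polynomials *)

Section Codimension.
Variables (R : realType) (l : nat).
Hypothesis l_gt0 : (0 < l)%N.
Implicit Types (f g h : cpoly R l) (m a b : 'X_{1..l}) (i : 'I_l).

(** In terms of this function the codimension of a structure is the excess of the
    degree minus the sum of the excesses of the degrees of the factors. *)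
Definition excess m : nat := #|monomle m|.-1.

Lemma excessD a b : (excess a + excess b <= excess (a + b)%MM)%N.
Proof.
rewrite /excess; have := card_monomleD a b.
by have := card_monomle_gt0 a; have := card_monomle_gt0 b; lia.
Qed.

Lemma excess0 : excess 0%MM = 0%N.
Proof. by rewrite /excess card_monomle0. Qed.

Lemma excess_gt0 m : m != 0%MM -> (0 < excess m)%N.
Proof. by move=> /card_monomle_gt1; rewrite /excess; lia. Qed.

Lemma excess_sum (I : Type) (r : seq I) (P : pred I) (F : I -> 'X_{1..l}) :
  (\sum_(i <- r | P i) excess (F i) <= excess (\sum_(i <- r | P i) F i)%MM)%N.
Proof.
elim/big_rec2: _ => [|i m n _ le]; first by rewrite excess0.
by apply: leq_trans (excessD _ _); rewrite leq_add2l.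
Qed.

Lemma irreducibleZ (c : R[i]) f :
  c != 0 -> irreducible_mpoly f -> irreducible_mpoly (c *: f).
Proof.
move=> nc [nf nU irr]; have Uc : (c%:MP_[l] : cpoly R l) \is a GRing.unit.
  by rewrite unit_multideg mpolyC_eq0 nc multidegC eqxx.
split; rewrite -?mul_mpolyC; first by rewrite mulf_neq0 ?mpolyC_eq0.
  by rewrite unitrM Uc.
move=> g h E; have [|Ug|] := irr (c^-1%:MP * g) h; last by right.
  by rewrite -mulrA -E mulrA -mpolyCM mulVf // mpolyC1 mul1r.
by left; move: Ug; rewrite unitrM => /andP[].
Qed.

Lemma linear_prime_prod (I : finType) (P : pred I) (F : I -> cpoly R l) i c :
  dvd_mpoly ('X_i - c%:MP) (\prod_(x | P x) F x) ->
  exists2 x, P x & dvd_mpoly ('X_i - c%:MP) (F x).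
Proof.
pose Q f := dvd_mpoly ('X_i - c%:MP) f -> exists2 x, P x & dvd_mpoly ('X_i - c%:MP) (F x).
apply: (big_ind Q) => [d1|f g Qf Qg /linear_prime[]//|x Px dx]; last by exists x.
by have := dvd_unit d1 (unitr1 _); rewrite (negbTE (linear_nonunit i c)).
Qed.

Section FromFactors.
Variables (al : R[i]) (r : nat) (g : 'I_r -> cpoly R l) (k : 'I_r -> nat).
Hypothesis al_neq0 : al != 0.
Hypothesis g_irr : forall j, irreducible_mpoly (g j) /\ (0 < k j)%N.
Hypothesis g_coprime : forall x y, x != y -> coprime_mpoly (g x) (g y).

Let f := al *: \prod_(j < r) g j ^+ k j.

Let g_neq0 j : g j != 0.
Proof. by have [[]] := g_irr j. Qed.

Let gd_neq0 j : multideg (g j) != 0%MM.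
Proof. by have [/irreducible_multideg] := g_irr j. Qed.

Lemma factors_multideg : multideg f = (\sum_j multideg (g j) *+ k j)%MM.
Proof.
rewrite multidegZ // multideg_prod => [|j]; last exact: expf_neq0.
by apply: eq_bigr => j _; rewrite multidegX.
Qed.

Lemma factors_multidegD1 j : multideg f =
  (multideg (g j) *+ k j + \sum_(x < r | x != j) multideg (g x) *+ k x)%MM.
Proof. by rewrite factors_multideg (bigD1 j). Qed.

Lemma excess_Mn j :
  (k j * excess (multideg (g j)) <= excess (multideg (g j) *+ k j)%MM)%N.
Proof. by apply: card_monomle_Mn; have [] := g_irr j. Qed.

Lemma excess_factors_ge :
  (\sum_j k j * excess (multideg (g j)) <= excess (multideg f))%N.
Proof.
rewrite factors_multideg; apply: leq_trans (excess_sum _ _ _).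
by apply: leq_sum => j _; apply: excess_Mn.
Qed.

(** A double root of a product of distinct irreducible factors would force two
    of them to share the same linear factor. *)
Lemma squarefree_no_multiple_root i c :
  (forall j, k j = 1%N) -> ~ multiple_root i f c.
Proof.
move=> k1 [q Eq]; pose p : cpoly R l := 'X_i - c%:MP.
have Ef : f = al%:MP * \prod_j g j.
  by rewrite /f -mul_mpolyC; congr (_ * _); apply: eq_bigr => j _; rewrite k1.
have nU_al : ~ dvd_mpoly p al%:MP.
  move=> /dvd_unit Up; have := linear_nonunit i c; rewrite -/p Up //.
  by rewrite unit_multideg mpolyC_eq0 al_neq0 multidegC eqxx.
have [|//|/linear_prime_prod[j _ [u Eu]]] := @linear_prime R l i c al%:MP (\prod_j g j).
  by exists (p * q); rewrite -Ef Eq expr2 mulrA.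
have Uu : u \is a GRing.unit.
  have [[_ _ /(_ _ _ Eu)[]//]] := g_irr j.
  by rewrite (negbTE (linear_nonunit i c)).
have E2 : al%:MP * (u * \prod_(x | x != j) g x) = p * q.
  apply: (mulfI (linear_neq0 i c)); rewrite -/p (mulrA p p q) -expr2 -Eq Ef.
  rewrite (mulrCA p) [in RHS](bigD1 j) //= {1}Eu (mulrA p u); reflexivity.
have [|//|] := @linear_prime R l i c al%:MP (u * \prod_(x | x != j) g x).
  by rewrite E2; exists q.
case/linear_prime => [/dvd_unit/(_ Uu)|]; first by rewrite (negbTE (linear_nonunit i c)).
case/linear_prime_prod => x xj dx.
have := linear_nonunit i c; rewrite (g_coprime xj dx) //.
by exists u.
Qed.

(** If the excess of the degree does not exceed the sum of the excesses of the
    factors, every superadditivity inequality is an equality: the exponents are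
    all 1, and either there is a single factor or one variable occurs. *)
Lemma excess_le_trivial :
  (excess (multideg f) <= \sum_j excess (multideg (g j)))%N -> trivial_poly f.
Proof.
move=> le.
have le_k j : (excess (multideg (g j)) <= k j * excess (multideg (g j)))%N.
  by rewrite leq_pmull //; have [] := g_irr j.
have k1 j : k j = 1%N.
  have tot_le := leq_trans excess_factors_ge le; move: tot_le.
  rewrite (bigD1 j) //= [X in (_ <= X)%N](bigD1 j) //= => tot_le.
  have sum_le : (\sum_(x < r | x != j) excess (multideg (g x)) <=
                 \sum_(x < r | x != j) k x * excess (multideg (g x)))%N.
    exact: leq_sum.
  have e_gt0 := excess_gt0 (gd_neq0 j); have [_ k_gt0] := g_irr j; apply/eqP.
  rewrite eqn_leq k_gt0 andbT -(leq_pmul2r e_gt0) mul1n.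
  rewrite -(leq_add2r (\sum_(x < r | x != j) k x * excess (multideg (g x)))).
  by apply: leq_trans tot_le _; rewrite leq_add2l.
have no_mult i c := @squarefree_no_multiple_root i c k1.
have [r0|r_gt0] := posnP r.
  apply: unit_trivial => //; rewrite unit_multideg; apply/andP; split.
    rewrite /f scaler_eq0 negb_or al_neq0 /=.
    by apply/prodf_neq0 => j _; rewrite expf_neq0.
  rewrite factors_multideg big1 // => j _.
  by have := leq_trans (ltn_ord j) (eq_leq r0).
pose j := Ordinal r_gt0.
pose rest := (\sum_(x < r | x != j) multideg (g x) *+ k x)%MM.
have [rest0|nrest] := eqVneq rest 0%MM.
  left; rewrite /f (bigD1 j) //= k1 expr1 big1 ?mulr1.
    by apply: irreducibleZ => //; have [] := g_irr j.
  move=> x xj; have := excess_sum (index_enum _) (fun x => x != j)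
    (fun x => multideg (g x) *+ k x)%MM.
  rewrite -/rest rest0 excess0 (bigD1 x) //= k1 mulm1n.
  by have := excess_gt0 (gd_neq0 x); lia.
have Ef : multideg f = (multideg (g j) + rest)%MM.
  by rewrite (factors_multidegD1 j) k1 mulm1n.
have [|i uni] := @card_monomleD_eq _ _ _ (gd_neq0 j) nrest.
  have rest_le : (\sum_(x < r | x != j) excess (multideg (g x)) <= excess rest)%N.
    apply: leq_trans (excess_sum _ _ _); apply: leq_sum => x _.
    by rewrite k1 mulm1n.
  move: le; rewrite Ef (bigD1 j) //= => le.
  have := leq_trans le (leq_add (leqnn _) rest_le).
  rewrite /excess; have := card_monomle_gt0 (multideg (g j) + rest)%MM.
  by have := card_monomle_gt0 (multideg (g j)); have := card_monomle_gt0 rest; lia.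
right; exists i => [x xi|c]; last exact: no_mult.
by rewrite Ef uni.
Qed.

(** In one variable the excess is the degree, hence additive, and exponents
    above 1 would create double roots. *)
Lemma trivial_excess_le : trivial_poly f ->
  (excess (multideg f) <= \sum_j excess (multideg (g j)))%N.
Proof.
case=> [[_ nU irr]|[i uni nomult]].
  have [r0|r_gt0] := posnP r.
    case/negP: nU; rewrite unit_multideg /f scaler_eq0 negb_or al_neq0 /=.
    apply/andP; split; first by apply/prodf_neq0 => j _; rewrite expf_neq0.
    by rewrite factors_multideg big1 // => j _; have := leq_trans (ltn_ord j) (eq_leq r0).
  pose j := Ordinal r_gt0.
  pose w := al *: (g j ^+ (k j).-1 * \prod_(x | x != j) g x ^+ k x).
  have Ef : f = g j * w.
    have [_ /prednK k_gt0] := g_irr j.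
    by rewrite /f (bigD1 j) //= /w -{1}k_gt0 exprS -scalerAr mulrA.
  have [|] := irr _ _ Ef.
    by rewrite unit_multideg (negbTE (gd_neq0 j)) andbF.
  rewrite unit_multideg => /andP[nw /eqP w0].
  by rewrite Ef multidegM // w0 addm0 (bigD1 j) //= leq_addr.
have uni_g j x : x != i -> multideg (g j) x = 0%N.
  move=> /uni; rewrite (factors_multidegD1 j) mnmDE mulmnE => /eqP.
  have [_ k_gt0] := g_irr j; rewrite addn_eq0 muln_eq0 -[k j == _]negbK -lt0n.
  by rewrite k_gt0 orbF => /andP[/eqP].
have k1 j : k j = 1%N.
  have [_ k_gt0] := g_irr j; apply/eqP; rewrite eqn_leq k_gt0 andbT leqNgt.
  apply/negP => k2; have [c [q Eq]] := univariate_root (uni_g j) (gd_neq0 j).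
  pose others := \prod_(x | x != j) g x ^+ k x.
  apply: (nomult c); exists (q ^+ 2 * (al *: (g j ^+ (k j).-2 * others))).
  have k_split : k j = (2 + (k j).-2)%N by lia.
  rewrite /f (bigD1 j) //= {1}k_split exprD {1}Eq exprMn.
  by rewrite -!scalerAr -!mulrA.
rewrite /excess (card_monomle_uni uni) /= factors_multideg mnm_sumE.
apply: leq_sum => j _; rewrite mulmnE k1 muln1.
by rewrite (card_monomle_uni (uni_g j)).
Qed.

Lemma factors_fcodim (M : fstructure l) :
  perm_eq M [seq (multideg (g j), k j) | j <- enum 'I_r] ->
  fcodim R (multideg f) M =
  (excess (multideg f))%:Z - (\sum_j excess (multideg (g j)))%:Z.
Proof.
move=> perm; rewrite /fcodim (perm_big _ perm) (perm_size perm) big_map.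
rewrite size_map size_enum_ord big_enum /= pdimE /excess.
have -> : \sum_j (pdim R (multideg (g j)))%:Z =
    (\sum_j (#|monomle (multideg (g j))|.-1))%:Z + r%:Z.
  rewrite -[in r%:Z](card_ord r) -sum1_card.
  elim/big_rec3: _ => // j x y z _ ->; rewrite pdimE !PoszD.
  by have := card_monomle_gt0 (multideg (g j)); lia.
have c_gt0 := card_monomle_gt0 (multideg f).
by rewrite -{1}(prednK c_gt0) -addn1 PoszD; ring.
Qed.

End FromFactors.

Lemma fstructure_multideg f M : has_fstructure f M ->
  multideg f = (\sum_(p <- M) p.1 *+ p.2)%MM.
Proof.
move=> [al [r [g [k [nal -> irr _ perm]]]]].
rewrite factors_multideg // (perm_big _ perm) big_map big_enum /=.
by apply: eq_bigr.
Qed.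

Lemma fcodim_trivial f M : has_fstructure f M ->
  (0 < fcodim R (multideg f) M <-> ~ trivial_poly f).
Proof.
move=> [al [r [g [k [nal -> irr cop perm]]]]].
rewrite (factors_fcodim nal perm); set f' := al *: _.
split=> [gt0 /(trivial_excess_le nal irr)|ntriv]; first by rewrite -/f'; lia.
rewrite subr_gt0 ltz_nat ltnNge; apply/negP => le.
exact/ntriv/(excess_le_trivial nal irr cop).
Qed.

Lemma singular_trivial f : singular f -> ~ trivial_poly f.
Proof. by move=> [d [M Mf ->]] /(fcodim_trivial Mf). Qed.

(** The structure with respect to which [f] is singular need not be [M]; triviality
    of [f] mediates between the two. *)
Lemma singular_nontrivial f M : has_fstructure f M ->
  singular f <-> nontrivial_fstructure R M.
Proof.
move=> Mf; split=> [sf [g Mg triv_g]|ntriv].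
  apply: (singular_trivial sf); apply: boolp.contrapT => /(fcodim_trivial Mf).
  rewrite (fstructure_multideg Mf) -(fstructure_multideg Mg).
  by move=> /(fcodim_trivial Mg).
exists (fcodim R (multideg f) M); first by exists M.
by apply/(fcodim_trivial Mf) => triv_f; apply: ntriv; exists f.
Qed.

End Codimension.

(** * Existence of factorizations *)

Section FactorizationExists.
Variables (R : realType) (l : nat).
Implicit Types (f g h d u v : cpoly R l).

Definition factorable f : Prop :=
  exists (al : R[i]) (r : nat) (g : 'I_r -> cpoly R l) (k : 'I_r -> nat),
    [/\ al != 0, f = al *: \prod_(j < r) g j ^+ k j,
        forall j, irreducible_mpoly (g j) /\ (0 < k j)%N &
        forall i j, i != j -> coprime_mpoly (g i) (g j)].

Lemma unit_scalar u : u \is a GRing.unit -> exists2 c : R[i], c != 0 & u = c%:MP.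
Proof.
rewrite unit_multideg => /andP[nu /eqP /multideg_eq0 E].
by exists u@_0%MM => //; move: nu; rewrite {1}E mpolyC_eq0.
Qed.

Lemma not_coprime_associate f g : irreducible_mpoly f -> irreducible_mpoly g ->
  ~ coprime_mpoly f g -> exists2 c : R[i], c != 0 & f = c *: g.
Proof.
move=> [_ _ irr_f] [_ _ irr_g] ncop; apply: boolp.contrapT => no.
apply: ncop => d [u Eu] [v Ev]; have [//|Uu] := irr_f _ _ Eu.
have [//|Uv] := irr_g _ _ Ev; case: no.
have [a na Ea] := unit_scalar Uu; have [b nb Eb] := unit_scalar Uv.
exists (a / b); first by rewrite mulf_neq0 ?invr_eq0.
rewrite Eu Ev Ea Eb -!mul_mpolyC mulrCA; congr (_ * _).
by rewrite -mpolyCM divfK.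
Qed.

Lemma factorable_scale (c : R[i]) f : c != 0 -> factorable f -> factorable (c *: f).
Proof.
move=> nc [al [r [g [k [nal -> irr cop]]]]]; exists (c * al), r, g, k.
by split=> //; [rewrite mulf_neq0 | rewrite scalerA].
Qed.

Lemma coprime_sym f g : coprime_mpoly f g -> coprime_mpoly g f.
Proof. by move=> cop d dg df; apply: cop. Qed.

Lemma factorable_irreducible f q :
  irreducible_mpoly q -> factorable f -> factorable (q * f).
Proof.
move=> irr_q [al [r [g [k [nal -> irr cop]]]]].
have [[j ncop]|all_cop] := boolp.EM (exists j, ~ coprime_mpoly q (g j)).
  have [irr_j k_gt0] := irr j.
  have [c nc Ec] := not_coprime_associate irr_q irr_j ncop.
  exists (c * al), r, g, (fun i => k i + (i == j))%N.
  split=> //; first by rewrite mulf_neq0.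
    rewrite Ec (bigD1 j) //= [in RHS](bigD1 j) //= eqxx addn1 exprS.
    rewrite [in RHS](eq_bigr (fun i => g i ^+ k i)); last first.
      by move=> i /negbTE ->; rewrite addn0.
    by rewrite -scalerAl -scalerAr scalerA -mulrA.
  by move=> i; have [irr_i ki_gt0] := irr i; split=> //; rewrite addn_gt0 ki_gt0.
have cop_q j : coprime_mpoly q (g j).
  by apply: boolp.contrapT => ncop; apply: all_cop; exists j.
exists al, r.+1, (fun x => oapp g q (unlift ord0 x)).
exists (fun x => oapp k 1%N (unlift ord0 x)).
split=> //.
- rewrite big_ord_recl unlift_none /= expr1 -scalerAr; congr (_ *: (_ * _)).
  by apply: eq_bigr => i _; rewrite liftK.
- by move=> x; case: unliftP => [i|] _ //=; exact: irr.
- move=> x y; case: unliftP => [i ->|->]; case: unliftP => [j ->|->] //= ne.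
  + by apply: cop; apply: contraNneq ne => ->.
  + exact: coprime_sym.
Qed.

(** Generalized over a second factor, so that a proper factorization of the
    first one splits the task into two smaller ones. *)
Lemma factorableM f h : f != 0 -> factorable h -> factorable (f * h).
Proof.
have [n] := ubnP (mdeg (multideg f)); elim: n f h => // n IHn f h le_n nf fh.
have [/unit_scalar[c nc ->]|nU] := boolP (f \is a GRing.unit).
  by rewrite mul_mpolyC; apply: factorable_scale.
have [irr|red] := boolp.EM (irreducible_mpoly f); first exact: factorable_irreducible.
have [g1 [g2 [E nU1 nU2]]] := reducible_factors nU nf red.
have [n1 n2] : g1 != 0 /\ g2 != 0 by apply/andP; rewrite -negb_or -mulf_eq0 -E.
have := multideg_nonunit n1 nU1; have := multideg_nonunit n2 nU2.
move: le_n; rewrite E multidegM // mdegD -!mdeg_eq0 => le_n d1 d2.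
by rewrite -mulrA; apply: (IHn) => //; [lia | apply: (IHn) => //; lia].
Qed.

Lemma fstructure_exists f : f != 0 -> exists M, has_fstructure f M.
Proof.
move=> nf; have f1 : factorable 1.
  exists 1, 0%N, (fun=> 1), (fun=> 1%N); split=> [|||i []//]; first exact: oner_neq0.
    by rewrite big_ord0 scale1r.
  by case.
have [al [r [g [k [nal E irr cop]]]]] := factorableM nf f1.
exists [seq (multideg (g j), k j) | j <- enum 'I_r], al, r, g, k.
by split=> //; rewrite -E mulr1.
Qed.

End FactorizationExists.

(** A polynomial without any structure would be nonsingular for a void reason,
    whence the appeal to the existence of factorizations. *)
Lemma nonsingularP (R : realType) (l : nat) (l_gt0 : (0 < l)%N) (f : cpoly R l) :
  f != 0 -> nonsingular f <-> trivial_poly f.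
Proof.
move=> nf; split=> [nsing|triv_f sing]; last exact: singular_trivial sing triv_f.
apply: boolp.contrapT => ntriv; have [M Mf] := fstructure_exists nf; apply: nsing.
by exists (fcodim R (multideg f) M); [exists M | apply/(fcodim_trivial l_gt0 Mf)].
Qed.

(** * Polynomials on a compact polydisc *)

Section SquaredModulus.
Variable R : rcfType.
Implicit Types x y : R[i].

Definition sqmod x : R := complex.Re x ^+ 2 + complex.Im x ^+ 2.

Lemma sqmod_ge0 x : 0 <= sqmod x.
Proof. by rewrite addr_ge0 ?sqr_ge0. Qed.

Lemma sqmod_eq0 x : (sqmod x == 0) = (x == 0).
Proof.
by case: x => a b; rewrite /sqmod paddr_eq0 ?sqr_ge0 //= !sqrf_eq0 eq_complex.
Qed.

Lemma sqmodM x y : sqmod (x * y) = sqmod x * sqmod y.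
Proof. by case: x y => [a b] [c d]; rewrite /sqmod /=; ring. Qed.

Lemma sqmodB_le x y : sqmod (x - y) <= 2 * (sqmod x + sqmod y).
Proof.
case: x y => [a b] [c d]; rewrite /sqmod /=.
by have := sqr_ge0 (a + c); have := sqr_ge0 (b + d); nra.
Qed.

Lemma normc_sqmod x : ComplexField.Normc.normc x ^+ 2 = sqmod x.
Proof. by case: x => a b; rewrite /= sqr_sqrtr // addr_ge0 ?sqr_ge0. Qed.

End SquaredModulus.

Section PolydiscCompactness.
Import boolp classical_sets topology normedtype derive.
Import numFieldNormedType.Exports.
Variables (R : realType) (n : nat).

(** A product of squares rather than of discs, so that it is a box in the real
    coordinates. *)
Definition in_polydisc (z : 'I_n -> R[i]) : Prop :=
  forall i, `|complex.Re (z i)| <= 1 /\ `|complex.Im (z i)| <= 1.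

Let point (v : 'rV[R]_(n + n)) (i : 'I_n) : R[i] :=
  complex.Complex (v ord0 (lshift n i)) (v ord0 (rshift n i)).

Let ccontinuous (F : 'rV[R]_(n + n) -> R[i]) : Prop :=
  continuous (fun v => complex.Re (F v)) /\ continuous (fun v => complex.Im (F v)).

Let ccontinuous_cst c : ccontinuous (fun=> c).
Proof. by split=> v; exact: cst_continuous. Qed.

Let ccontinuousD F G : ccontinuous F -> ccontinuous G -> ccontinuous (fun v => F v + G v).
Proof.
move=> [Fr Fi] [Gr Gi]; split=> v.
  have -> : (fun v => complex.Re (F v + G v)) =
    (fun v => complex.Re (F v) + complex.Re (G v)).
    by apply: funext => w; case: (F w) (G w) => [? ?] [? ?].
  by apply: continuousD; [exact: Fr | exact: Gr].
have -> : (fun v => complex.Im (F v + G v)) =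
  (fun v => complex.Im (F v) + complex.Im (G v)).
  by apply: funext => w; case: (F w) (G w) => [? ?] [? ?].
by apply: continuousD; [exact: Fi | exact: Gi].
Qed.

Let ccontinuousM F G : ccontinuous F -> ccontinuous G -> ccontinuous (fun v => F v * G v).
Proof.
move=> [Fr Fi] [Gr Gi]; split=> v.
  have -> : (fun v => complex.Re (F v * G v)) =
    (fun v => complex.Re (F v) * complex.Re (G v) - complex.Im (F v) * complex.Im (G v)).
    by apply: funext => w; case: (F w) (G w) => [? ?] [? ?].
  exact: (continuousD (continuousM (Fr v) (Gr v))
                      (continuousN (continuousM (Fi v) (Gi v)))).
have -> : (fun v => complex.Im (F v * G v)) =
  (fun v => complex.Re (F v) * complex.Im (G v) + complex.Im (F v) * complex.Re (G v)).
  by apply: funext => w; case: (F w) (G w) => [? ?] [? ?].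
exact: (continuousD (continuousM (Fr v) (Gi v)) (continuousM (Fi v) (Gr v))).
Qed.

Let ccontinuous_meval (q : {mpoly R[i][n]}) : ccontinuous (fun v => q.@[point v]).
Proof.
have -> : (fun v => q.@[point v]) =
  (fun v => \sum_(mu <- msupp q) q@_mu * \prod_i point v i ^+ mu i).
  by apply: funext => v; rewrite mevalE.
elim: (msupp q) => [|mu s IHs].
  under [X in ccontinuous X]funext do rewrite big_nil; exact: ccontinuous_cst.
under [X in ccontinuous X]funext do rewrite big_cons; apply: ccontinuousD => //.
apply: ccontinuousM; first exact: ccontinuous_cst.
elim: (index_enum _) => [|i r IHr].
  under [X in ccontinuous X]funext do rewrite big_nil; exact: ccontinuous_cst.
under [X in ccontinuous X]funext do rewrite big_cons; apply: ccontinuousM => //.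
elim: (mu i) => [|k IHk].
  under [X in ccontinuous X]funext do rewrite expr0; exact: ccontinuous_cst.
under [X in ccontinuous X]funext do rewrite exprS; apply: ccontinuousM => //.
by split=> v; exact: coord_continuous.
Qed.

Let sqmod_continuous (I : finType) (q : I -> {mpoly R[i][n]}) :
  continuous (fun v => \sum_i sqmod (q i).@[point v]).
Proof.
elim: (index_enum _) => [|i r IHr] v.
  under [X in continuous_at _ X]funext do rewrite big_nil; exact: cst_continuous.
under [X in continuous_at _ X]funext do rewrite big_cons.
have [qr qi] := ccontinuous_meval (q i).
have sq : {for v, continuous (fun v => sqmod (q i).@[point v])}.
  exact: (continuousD (continuousM (qr v) (qr v)) (continuousM (qi v) (qi v))).
exact: (continuousD sq (IHr v)).
Qed.

Let box : set 'rV[R]_(n + n) := [set v | forall i, `[-1, 1]%classic (v ord0 i)]%classic.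

Let box_compact : compact box.
Proof.
have compact_prod :=
  @rV_compact R (n + n) (fun=> `[-1, 1]%classic) (fun=> @segment_compact R _ _).
exact: compact_prod.
Qed.

Let box0 : (box !=set0)%classic.
Proof. by exists 0 => i /=; rewrite mxE in_itv /=; apply/andP; split; lra. Qed.

Let box_point v : box v -> in_polydisc (point v).
Proof.
by move=> bv i; split; [have := bv (lshift n i) | have := bv (rshift n i)];
  rewrite /= in_itv /= -ler_norml.
Qed.

Let point_box z : in_polydisc z -> exists2 v, box v & point v =1 z.
Proof.
move=> dz; exists (row_mx (\row_i complex.Re (z i)) (\row_i complex.Im (z i))).
  move=> i /=; rewrite in_itv /= -ler_norml mxE; case: splitP => j _; rewrite mxE.
    by have [] := dz j.
  by have [] := dz j.
move=> i; rewrite /point row_mxEl row_mxEr !mxE; by case: (z i).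
Qed.

Lemma polydisc_lower_bound (I : finType) (q : I -> {mpoly R[i][n]}) :
  (forall z, in_polydisc z -> exists i, (q i).@[z] != 0) ->
  exists2 c : R, 0 < c & forall z, in_polydisc z -> c <= \sum_i sqmod (q i).@[z].
Proof.
move=> nz; have [|v0 v0_box v0_min] := EVT_min_rV box0 box_compact
    (f := fun v => \sum_i sqmod (q i).@[point v]).
  exact/continuous_subspaceT/sqmod_continuous.
rewrite inE in v0_box; exists (\sum_i sqmod (q i).@[point v0]).
  have [i qi] := nz _ (box_point v0_box).
  rewrite (bigD1 i) //= ltr_pwDl ?sumr_ge0 // => [|j _]; last exact: sqmod_ge0.
  by rewrite lt_def sqmod_eq0 qi sqmod_ge0.
move=> z /point_box[v bv Ev].
apply: le_trans (v0_min v _) _; first by rewrite inE.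
by apply: ler_sum => i _; rewrite (meval_eq _ Ev).
Qed.

Lemma polydisc_upper_bound (I : finType) (q : I -> {mpoly R[i][n]}) :
  exists2 M : R, 0 < M & forall z, in_polydisc z -> \sum_i sqmod (q i).@[z] <= M.
Proof.
have [|v0 v0_box v0_max] := EVT_max_rV box0 box_compact
    (f := fun v => \sum_i sqmod (q i).@[point v]).
  exact/continuous_subspaceT/sqmod_continuous.
exists (\sum_i sqmod (q i).@[point v0] + 1).
  by rewrite ltr_wpDl ?ltr01 // sumr_ge0 // => i _; exact: sqmod_ge0.
move=> z /point_box[v bv Ev]; apply: (@le_trans _ _ (\sum_i sqmod (q i).@[point v])).
  by apply: ler_sum => i _; rewrite (meval_eq _ Ev).
by apply: le_trans (v0_max v _) _; rewrite ?inE // lerDl ler01.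
Qed.

End PolydiscCompactness.

(** * Charts for products of bounded degree *)

Section BoundedExpansion.
Variables (R : realType) (l : nat) (m : 'X_{1..l}).

Lemma leqm_mpolyX (x : monomle m) : ('X_[mle x] : cpoly R l) \in leqm m.
Proof.
apply/leqm_coeffP => mu nle; rewrite mcoeffX; case: eqP nle => // <-.
by rewrite mle_le.
Qed.

Lemma leqm_expansion (c : monomle m -> R[i]) : \sum_x c x *: 'X_[mle x] \in leqm m.
Proof. by apply: rpred_sum => x _; apply: rpredZ; exact: leqm_mpolyX. Qed.

Lemma mcoeff_expansion (c : monomle m -> R[i]) x :
  (\sum_y c y *: 'X_[mle y])@_(mle x) = c x.
Proof.
rewrite raddf_sum (bigD1 x) //= mcoeffZ mcoeffX eqxx mulr1 big1 ?addr0 // => y ne.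
by rewrite mcoeffZ mcoeffX (inj_eq (@mle_inj l m)) (negbTE ne) mulr0.
Qed.

Lemma leqm_eq (f g : cpoly R l) : f \in leqm m -> g \in leqm m ->
  (forall x : monomle m, f@_(mle x) = g@_(mle x)) -> f = g.
Proof.
move=> /leqm_coeffP fm /leqm_coeffP gm E; apply/mpolyP => mu.
have [le|nle] := boolP (mu <= m)%MM; last by rewrite fm ?gm.
by have [x <-] := mle_surj le.
Qed.

Lemma expansionE (f : cpoly R l) :
  f \in leqm m -> f = \sum_(x : monomle m) f@_(mle x) *: 'X_[mle x].
Proof.
move=> fm; apply: leqm_eq => // [|x]; first exact: leqm_expansion.
by rewrite mcoeff_expansion.
Qed.

Lemma dominant_coefficient (f : cpoly R l) : f \in leqm m -> f != 0 ->
  exists2 x : monomle m, f@_(mle x) != 0 &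
    forall y : monomle m, sqmod f@_(mle y) <= sqmod f@_(mle x).
Proof.
move=> fm nf; pose F y := sqmod f@_(mle (y : monomle m)).
have [x _ x_max] := @Order.TotalTheory.arg_maxP _ _ _ (monom (lepm_refl m)) xpredT F isT.
exists x => [|y]; last exact: x_max.
apply: contraNneq nf => fx0; apply/eqP; apply: leqm_eq => //; first exact: rpred0.
move=> y; rewrite mcoeff0; apply/eqP; rewrite -sqmod_eq0 eq_le sqmod_ge0 andbT.
by apply: le_trans (x_max y isT) _; rewrite /F fx0 le_eqVlt sqmod_eq0 eqxx.
Qed.

End BoundedExpansion.

Section Chart.
Variables (R : realType) (l s : nat) (a b : 'X_{1..l}).
Variables (mu : monomle a) (nu : monomle b).

(** The coefficients of two factors of degrees at most [a] and [b], except for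
    those at [mu] and [nu], which are normalized to 1. *)
Definition chart_index : predArgType :=
  {x : (monomle a + monomle b)%type | (x != inl mu) && (x != inr nu)}.
HB.instance Definition _ := Finite.on chart_index.

Definition chart_dim : nat := #|chart_index|.

Definition chart_coef (x : monomle a + monomle b) : {mpoly R[i][chart_dim]} :=
  if insub x is Some j then 'X_(enum_rank (j : chart_index)) else 1.

Definition chart : {mpoly {mpoly R[i][chart_dim]}[l]} :=
  (\sum_x chart_coef (inl x) *: 'X_[mle x]) ^+ s *
  (\sum_y chart_coef (inr y) *: 'X_[mle y]).

Lemma chart_dimE : chart_dim.+2 = (#|monomle a| + #|monomle b|)%N.
Proof.
have -> : chart_dim = #|[set~ inl mu] :\ inr nu|.
  by rewrite /chart_dim card_sig; apply: eq_card => x; rewrite !inE; exact: andbC.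
have nu_in : inr nu \in [set~ (inl mu : monomle a + monomle b)] by rewrite !inE.
have E : #|{: monomle a + monomle b}| = (#|monomle a| + #|monomle b|)%N.
  exact: card_sum.
have := cardsC1 (inl mu : monomle a + monomle b); rewrite E.
rewrite (cardsD1 (inr nu)) nu_in add1n => ->; rewrite prednK //.
by rewrite addn_gt0 card_monomle_gt0.
Qed.

Section Point.
Variable z : 'I_chart_dim -> R[i].

Definition chart_left : cpoly R l := \sum_x (chart_coef (inl x)).@[z] *: 'X_[mle x].
Definition chart_right : cpoly R l := \sum_y (chart_coef (inr y)).@[z] *: 'X_[mle y].

Lemma chart_at : map_mpoly (meval z) chart = chart_left ^+ s * chart_right.
Proof.
pose phi : {rmorphism {mpoly {mpoly R[i][chart_dim]}[l]} -> {mpoly R[i][l]}} :=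
  map_mpoly (meval z).
have phi_sum (I : finType) (c : I -> {mpoly R[i][chart_dim]}) (e : I -> 'X_{1..l}) :
    phi (\sum_x c x *: 'X_[e x]) = \sum_x (c x).@[z] *: 'X_[e x].
  rewrite (raddf_sum phi); apply: eq_bigr => x _.
  by rewrite /phi /= map_mpolyZ map_mpolyX.
rewrite -[map_mpoly _ _]/(phi chart) /chart (rmorphM phi) (rmorphXn phi).
by rewrite !phi_sum.
Qed.

Lemma chart_left_neq0 : chart_left != 0.
Proof.
apply/eqP => /mpolyP/(_ (mle mu)); rewrite mcoeff_expansion mcoeff0 /chart_coef.
by rewrite insubF ?eqxx // meval1 => /eqP; rewrite oner_eq0.
Qed.

Lemma chart_right_neq0 : chart_right != 0.
Proof.
apply/eqP => /mpolyP/(_ (mle nu)); rewrite mcoeff_expansion mcoeff0 /chart_coef.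
by rewrite insubF ?eqxx ?andbF // meval1 => /eqP; rewrite oner_eq0.
Qed.

Lemma chart_left_leqm : chart_left \in leqm a.
Proof. exact: leqm_expansion. Qed.

Lemma chart_right_leqm : chart_right \in leqm b.
Proof. exact: leqm_expansion. Qed.

End Point.
End Chart.

(** Dividing each factor by a coefficient of largest modulus puts it into a
    chart, with parameters in the unit polydisc. *)
Lemma chart_cover (R : realType) (l s : nat) (a b : 'X_{1..l}) (g h : cpoly R l) :
  g \in leqm a -> h \in leqm b -> g != 0 -> h != 0 ->
  exists (mu : monomle a) (nu : monomle b) (z : 'I_(chart_dim mu nu) -> R[i]) lam,
    in_polydisc z /\ g ^+ s * h = lam *: map_mpoly (meval z) (chart R s mu nu).
Proof.
move=> ga hb ng nh; have [mu g_mu g_max] := dominant_coefficient ga ng.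
have [nu h_nu h_max] := dominant_coefficient hb nh; exists mu, nu.
pose q (x : monomle a + monomle b) : R[i] :=
  match x with inl x => g@_(mle x) / g@_(mle mu) | inr y => h@_(mle y) / h@_(mle nu) end.
pose z (j : 'I_(chart_dim mu nu)) := q (val (enum_val j : chart_index mu nu)).
exists z, (g@_(mle mu) ^+ s * h@_(mle nu)).
have le1 (c d : R[i]) : d != 0 -> sqmod c <= sqmod d -> sqmod (c / d) <= 1.
  move=> nd le; have sd : 0 < sqmod d by rewrite lt_def sqmod_eq0 nd sqmod_ge0.
  by rewrite -(ler_pM2r sd) -sqmodM divfK // mul1r.
have qz x : (chart_coef R mu nu x).@[z] = q x.
  rewrite /chart_coef; case: insubP => [j _ <-|]; first by rewrite mevalXU /z enum_rankK.
  by move/nandP => [] /negPn/eqP ->; rewrite meval1 /q divff.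
split=> [j|].
  have : sqmod (z j) <= 1 by rewrite /z; case: (val _) => x; exact: le1.
  by rewrite /sqmod => le; split; rewrite ler_norml; apply/andP; split; nra.
have gE : chart_left z = (g@_(mle mu))^-1 *: g.
  rewrite {2}(expansionE ga) scaler_sumr; apply: eq_bigr => x _.
  by rewrite qz scalerA mulrC.
have hE : chart_right z = (h@_(mle nu))^-1 *: h.
  rewrite {2}(expansionE hb) scaler_sumr; apply: eq_bigr => x _.
  by rewrite qz scalerA mulrC.
rewrite chart_at gE hE exprZn -scalerAl -scalerAr !scalerA mulrAC mulfK //.
by rewrite exprVn mulfV ?expf_neq0 // scale1r.
Qed.

(** * Algebraic dependence *)

Section AlgebraicDependence.
Variable F : fieldType.

Lemma mdeg_msuppM n (p q : {mpoly F[n]}) c d :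
  {in msupp p, forall mu, mdeg mu <= c}%N -> {in msupp q, forall mu, mdeg mu <= d}%N ->
  {in msupp (p * q), forall mu, mdeg mu <= c + d}%N.
Proof.
move=> pc qd mu /msuppM_le /allpairsP[[x y] /= [xp yq ->]].
by rewrite mdegD leq_add ?pc ?qd.
Qed.

Lemma mdeg_msuppX n (p : {mpoly F[n]}) c e :
  {in msupp p, forall mu, mdeg mu <= c}%N ->
  {in msupp (p ^+ e), forall mu, mdeg mu <= e * c}%N.
Proof.
move=> pc; elim: e => [|e IHe].
  by rewrite expr0 -mpolyC1 msupp1 => mu; rewrite mem_seq1 => /eqP->; rewrite mdeg0.
by rewrite exprS mulSn; apply: mdeg_msuppM.
Qed.

(** More polynomials than variables are algebraically dependent: there are
    [D^k] products of powers with exponents below [D], and for large [D] these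
    outnumber the monomials, at most [((kB+1)D)^n], that can occur in them. *)
Lemma algebraic_dependence n k (p : 'I_k -> {mpoly F[n]}) : (n < k)%N ->
  exists2 Q : {mpoly F[k]}, Q != 0 & forall z, Q.@[fun i => (p i).@[z]] = 0.
Proof.
move=> n_lt_k; pose B := (\max_i msize (p i))%N.
pose D := ((k * B).+1 ^ n).+1; pose K := ((k * B).+1 * D)%N.
pose E : Type := {ffun 'I_k -> 'I_D}; pose S : Type := {ffun 'I_n -> 'I_K}.
have card_lt : (#|{: S}| < #|{: E}|)%N.
  rewrite !card_ffun !card_ord expnMn.
  apply: (@leq_trans (D * D ^ n)); last by rewrite -expnS leq_pexp2l.
  by rewrite ltn_pmul2r // expn_gt0.
pose w (e : E) : {mpoly F[n]} := \prod_i p i ^+ e i.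
have w_deg e : {in msupp (w e), forall mu, mdeg mu < K}%N.
  have le_K : (\sum_(i < k) e i * B < K)%N.
    apply: (@leq_ltn_trans (\sum_(i < k) D * B)).
      by apply: leq_sum => i _; rewrite leq_mul2r ltnW ?orbT.
    rewrite sum_nat_const card_ord /K mulSn mulnA mulnAC.
    by rewrite -[X in (X < _)%N]add0n ltn_add2r.
  move=> mu mu_w; apply: leq_ltn_trans le_K; move: mu mu_w; rewrite /w.
  elim/big_ind2: _ => [|x c y d xc yd|i _].
  - by rewrite -mpolyC1 msupp1 => mu; rewrite mem_seq1 => /eqP->; rewrite mdeg0.
  - exact: mdeg_msuppM.
  - apply: mdeg_msuppX => mu /msize_mdeg_lt/ltnW le; apply: leq_trans le _.
    exact: (@leq_bigmax _ (fun i => msize (p i))).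
(* A row vector in the kernel of this matrix is a linear relation between the
   products of powers. *)
pose A : 'M[F]_(#|{: E}|, #|{: S}|) :=
  \matrix_(e < #|{: E}|, x < #|{: S}|)
    (w (enum_val e))@_[multinom ((enum_val x : S) i : nat) | i < n].
have : kermx A != 0.
  rewrite kermx_eq0 /row_free; apply: contraTneq (rank_leq_col A) => ->.
  by rewrite -ltnNge.
case/rowV0Pn => u /sub_kermxP uA u_neq0.
pose mon (e : E) : 'X_{1..k} := [multinom (e i : nat) | i < k].
have mon_inj : injective mon.
  move=> e e' /mnmP mon_eq; apply/ffunP => i; apply: val_inj.
  by have := mon_eq i; rewrite !mnmE.
pose Q : {mpoly F[k]} := \sum_e u 0 e *: 'X_[mon (enum_val e)].
exists Q => [|z].
  have [j uj] : exists j, u 0 j != 0.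
    apply/existsP; apply: contraNT u_neq0; rewrite negb_exists => /forallP u0.
    by apply/eqP/rowP => j; rewrite mxE; apply/eqP; rewrite -[_ == _]negbK.
  apply: contraNneq uj => /mpolyP/(_ (mon (enum_val j))).
  rewrite mcoeff0 raddf_sum (bigD1 j) //= mcoeffZ mcoeffX eqxx mulr1.
  rewrite big1 ?addr0 => [->//|i ne].
  by rewrite mcoeffZ mcoeffX (inj_eq mon_inj) (inj_eq enum_val_inj) (negbTE ne) mulr0.
have comb0 : \sum_e u 0 e *: w (enum_val e) = 0.
  apply/mpolyP => mu; rewrite mcoeff0 raddf_sum /=.
  have [small|] := boolP [forall i, mu i < K]%N; last first.
    move=> /forallPn[j]; rewrite -leqNgt => big.
    rewrite big1 // => e _; rewrite mcoeffZ memN_msupp_eq0 ?mulr0 //.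
    apply: contraL big => /w_deg; rewrite -ltnNge; apply: leq_ltn_trans.
    by rewrite mdegE (bigD1 j) //= leq_addr.
  pose x : S := [ffun i => Ordinal (forallP small i)].
  have := congr1 (fun M : 'rV_#|{: S}| => M 0 (enum_rank x)) uA.
  rewrite mxE [X in _ = X]mxE => {2}<-; apply: eq_bigr => e _.
  rewrite mcoeffZ mxE enum_rankK; congr (_ * _@__).
  by apply/mnmP => i; rewrite mnmE ffunE.
transitivity ((\sum_e u 0 e *: w (enum_val e)).@[z]); last by rewrite comb0 meval0.
rewrite !raddf_sum; apply: eq_bigr => e _; rewrite /= !mevalZ mevalX; congr (_ * _).
rewrite rmorph_prod; apply: eq_bigr => i _.
by rewrite rmorphXn mnmE.
Qed.

(** One more parameter accounts for rescaling all polynomials at once. *)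
Lemma homogeneous_dependence n k (p : 'I_k -> {mpoly F[n]}) : (n.+1 < k)%N ->
  exists2 Q : {mpoly F[k]}, Q != 0 &
    forall (c : F) z, Q.@[fun i => c * (p i).@[z]] = 0.
Proof.
move=> n_lt_k.
pose wide := [tuple ('X_(lift ord0 i) : {mpoly F[n.+1]}) | i < n].
have [Q nQ Q0] :=
  @algebraic_dependence n.+1 k (fun i => 'X_ord0 * (p i \mPo wide)) n_lt_k.
exists Q => // c z; rewrite -[RHS](Q0 (fun j => oapp z c (unlift ord0 j))).
apply: meval_eq => i; rewrite mevalM mevalXU unlift_none comp_mpoly_meval; congr (_ * _).
by apply: meval_eq => j; rewrite tnth_mktuple mevalXU liftK.
Qed.

End AlgebraicDependence.

(** * Small perturbations avoiding a hypersurface *)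

Lemma base_expansion_inj k D (x y : 'I_k -> nat) :
  (forall i, x i < D)%N -> (forall i, y i < D)%N ->
  (\sum_(i < k) x i * D ^ i = \sum_(i < k) y i * D ^ i)%N -> x =1 y.
Proof.
elim: k x y => [x y _ _ _ []//|k IHk] x y xD yD.
have split_sum (u : 'I_k.+1 -> nat) : (\sum_(i < k.+1) u i * D ^ i =
    (\sum_(i < k) u (lift ord0 i) * D ^ i) * D + u ord0)%N.
  rewrite big_ord_recl expn0 muln1 addnC; congr addn; rewrite big_distrl /=.
  by apply: eq_bigr => i _; rewrite /bump /= add1n expnS mulnCA mulnC.
rewrite !split_sum => E.
have E0 : x ord0 = y ord0.
  by have := congr1 (modn^~ D) E; rewrite !modnMDl !modn_small.
have D_gt0 : (0 < D)%N by apply: leq_ltn_trans (xD ord0).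
have EH : x \o lift ord0 =1 y \o lift ord0.
  apply: IHk => [i|i|] /=; [exact: xD | exact: yD |].
  by move: E; rewrite E0 => /addIn /eqP; rewrite eqn_pmul2r // => /eqP.
by move=> i; case: (unliftP ord0 i) => [j ->|->] //; exact: EH.
Qed.

Section SmallPerturbation.
Variable R : realType.

Lemma small_nonroot (p : {poly R[i]}) (e : R) : p != 0 -> 0 < e ->
  exists2 t : R, 0 < t < e & p.[t%:C%C] != 0.
Proof.
move=> np e_gt0; pose t (j : nat) : R := e / j.+2%:R.
have t_inj : injective t.
  move=> j k /(mulfI (lt0r_neq0 e_gt0)) /invr_inj /eqP.
  by rewrite eqr_nat !eqSS => /eqP.
have tC_inj : injective (fun j => (t j)%:C%C) by move=> j k [] /t_inj.
pose rs := [seq (t j)%:C%C | j <- iota 0 (size p)].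
have : ~~ all (root p) rs.
  apply/negP => all_rt; have := max_poly_roots np all_rt.
  by rewrite map_inj_uniq // iota_uniq size_map size_iota ltnn => /(_ isT).
case/allPn => _ /mapP[j _ ->] nroot; exists (t j) => //.
rewrite /t divr_gt0 ?ltr0n //= ltr_pdivrMr ?ltr0n // ltr_pMr // ltr1n //.
Qed.

(** Kronecker's substitution [x_i = t^(D^i)] separates monomials with exponents
    below [D], so it turns [Q] into a nonzero univariate polynomial. *)
Lemma mpoly_nonvanishing k (Q : {mpoly R[i][k]}) : Q != 0 -> exists w, Q.@[w] != 0.
Proof.
move=> nQ; pose D := msize Q.
pose kron (mu : 'X_{1..k}) := (\sum_(j < k) mu j * D ^ j)%N.
pose p : {poly R[i]} := \sum_(mu <- msupp Q) Q@_mu *: 'X^(kron mu).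
have kron_inj : {in msupp Q &, injective kron}.
  have lt_D (mu : 'X_{1..k}) j : mu \in msupp Q -> (mu j < D)%N.
    move=> /msize_mdeg_lt; apply: leq_ltn_trans.
    by rewrite mdegE (bigD1 j) //= leq_addr.
  move=> mu nu mu_Q nu_Q E; apply/mnmP; apply: (base_expansion_inj (D := D)) => // j;
  exact: lt_D.
have np : p != 0.
  have mu_Q := mlead_supp nQ; apply/eqP => /polyP/(_ (kron (mlead Q))).
  rewrite coef0 coef_sum (bigD1_seq (mlead Q)) ?msupp_uniq //=.
  rewrite coefZ coefXn eqxx mulr1 big_seq_cond big1 ?addr0 => [/eqP|nu /andP[nu_Q ne]].
    by rewrite mcoeff_eq0 mu_Q.
  rewrite coefZ coefXn; case: eqP => [/kron_inj E|_]; last by rewrite mulr0.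
  by rewrite E ?eqxx in ne.
have [t _ nroot] := small_nonroot np (@ltr01 R).
exists (fun j => t%:C%C ^+ (D ^ j)); apply: contraNneq nroot => E.
apply/eqP; rewrite -E mevalE /p horner_sum; apply: eq_bigr => mu _.
rewrite hornerZ hornerXn; congr (_ * _); rewrite expr_sum.
by apply: eq_bigr => j _; rewrite -exprM mulnC.
Qed.

(** On the line through [v] and a point where [Q] does not vanish, [Q] has
    finitely many zeros. *)
Lemma nonvanishing_near k (Q : {mpoly R[i][k]}) (v w : 'I_k -> R[i]) (e : R) :
  Q.@[w] != 0 -> 0 < e ->
  exists2 t : R, 0 < t < e & Q.@[fun j => v j + t%:C%C * (w j - v j)] != 0.
Proof.
move=> Qw e_gt0; pose p : {poly R[i]} := \sum_(mu <- msupp Q)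
  Q@_mu *: \prod_j ((v j)%:P + (w j - v j) *: 'X) ^+ mu j.
have pE t : p.[t] = Q.@[fun j => v j + t * (w j - v j)].
  rewrite mevalE /p horner_sum; apply: eq_bigr => mu _.
  rewrite hornerZ horner_prod; congr (_ * _); apply: eq_bigr => j _.
  by rewrite horner_exp hornerD hornerC hornerZ hornerX [_ * t]mulrC.
have np : p != 0.
  apply: contraNneq Qw => p0; have := pE 1; rewrite p0 horner0 => E.
  by rewrite {}E; apply/eqP/meval_eq => j; rewrite mul1r addrC subrK.
by have [t t_e nroot] := small_nonroot np e_gt0; exists t => //; rewrite -pE.
Qed.

End SmallPerturbation.

Section CoefNorm.
Variables (R : realType) (l : nat).
Implicit Types (f g : cpoly R l).

Lemma coef_norm_ge0 f : 0 <= coef_norm f.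
Proof. exact: sqrtr_ge0. Qed.

Lemma coef_norm_sqr f : coef_norm f ^+ 2 = \sum_(mu <- msupp f) sqmod f@_mu.
Proof.
rewrite sqr_sqrtr; first by apply: eq_bigr => mu _; rewrite normc_sqmod.
by apply: sumr_ge0 => mu _; rewrite sqr_ge0.
Qed.

Lemma sqmod_coef_norm f mu : sqmod f@_mu <= coef_norm f ^+ 2.
Proof.
rewrite coef_norm_sqr; have [mu_f|/memN_msupp_eq0->] := boolP (mu \in msupp f).
  rewrite (bigD1_seq mu) ?msupp_uniq //= lerDl.
  by apply: sumr_ge0 => nu _; exact: sqmod_ge0.
have -> : sqmod (0 : R[i]) = 0 by apply/eqP; rewrite sqmod_eq0.
by apply: sumr_ge0 => nu _; exact: sqmod_ge0.
Qed.

Lemma coef_norm_scale (t : R) f : 0 < t -> coef_norm (t%:C%C *: f) = t * coef_norm f.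
Proof.
move=> t_gt0; have nt : t%:C%C != 0 :> R[i].
  by rewrite eq_complex /= eqxx andbT lt0r_neq0.
apply/eqP; rewrite -(eqrXn2 (n := 2)) ?coef_norm_ge0 //; last first.
  by rewrite mulr_ge0 ?coef_norm_ge0 // ltW.
rewrite exprMn !coef_norm_sqr (perm_big _ (msuppZ f nt)) mulr_sumr; apply/eqP.
apply: eq_bigr => mu _; rewrite mcoeffZ sqmodM; congr (_ * _).
by rewrite /sqmod /= expr0n addr0.
Qed.

End CoefNorm.

(** * Density *)

Section TopDegree.
Variables (R : realType) (l : nat).
Implicit Types (f : cpoly R l) (m : 'X_{1..l}).

Lemma multideg_squeeze m f : f \in leqm m -> f != 0 ->
  (m <= multideg f)%MM -> multideg f = m.
Proof.
move=> fm nf /mnm_lepP le; have /mnm_lepP ge := leqm_multideg fm nf.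
by apply/mnmP => j; apply/eqP; rewrite eqn_leq ge le.
Qed.

Lemma top_coef_multideg m f : f \in leqm m -> f@_m != 0 -> has_multideg m f.
Proof.
move=> fm fm0; have nf : f != 0 by apply: contraNneq fm0 => ->; rewrite mcoeff0.
split=> //; apply: multideg_squeeze => //; apply: multideg_ge.
by rewrite mcoeff_msupp.
Qed.

End TopDegree.

Section Splittings.
Variables (R : realType) (l : nat).
Implicit Types (f g h : cpoly R l) (a b m : 'X_{1..l}).

Definition coef_vector m f (j : 'I_#|monomle m|) : R[i] := f@_(mle (enum_val j)).
Arguments coef_vector : clear implicits.

(** The products [g ^+ s * h] lie, up to scaling, in finitely many charts with
    too few parameters to fill the space, so a nonzero polynomial in the
    coefficients vanishes on all of them. *)
Lemma strict_split_vanishing s a b m : m = (a *+ s + b)%MM -> strict_split s a b ->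
  exists2 Q : {mpoly R[i][#|monomle m|]}, Q != 0 &
    forall g h, g \in leqm a -> h \in leqm b -> g != 0 -> h != 0 ->
      Q.@[coef_vector m (g ^+ s * h)] = 0.
Proof.
move=> Em strict.
have chart_Q (t : monomle a * monomle b) :
    exists2 Q : {mpoly R[i][#|monomle m|]}, Q != 0 & forall (c : R[i]) z,
      Q.@[fun j => c * ((chart R s t.1 t.2)@_(mle (enum_val j : monomle m))).@[z]] = 0.
  by apply: homogeneous_dependence; rewrite chart_dimE Em.
have [Q nQ Q0] := fin_all_exists2 chart_Q; exists (\prod_t Q t).
  by apply/prodf_neq0.
move=> g h ga hb ng nh.
have [mu [nu [z [c [_ E]]]]] := @chart_cover R l s a b g h ga hb ng nh.
rewrite rmorph_prod (bigD1 (mu, nu)) //=.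
suff -> : (Q (mu, nu)).@[coef_vector m (g ^+ s * h)] = 0 by rewrite mul0r.
rewrite -[RHS](Q0 (mu, nu) c z); apply: meval_eq => j.
by rewrite /coef_vector E mcoeffZ mcoeff_map_mpoly.
Qed.

Definition split_index m : predArgType := ('I_3 * monomle m * monomle m)%type.
Definition is_split m (t : split_index m) : bool :=
  [&& (0 < t.1.1)%N, m == (mle t.1.2 *+ t.1.1 + mle t.2)%MM &
      strict_split t.1.1 (mle t.1.2) (mle t.2)].

Lemma nontrivial_split_index (l_gt0 : (0 < l)%N) f : f != 0 -> ~ trivial_poly f ->
  exists2 t : split_index (multideg f), is_split t &
    exists g h, [/\ f = g ^+ t.1.1 * h, g \in leqm (mle t.1.2), h \in leqm (mle t.2),
                    g != 0 & h != 0].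
Proof.
move=> nf /(nontrivial_split l_gt0 nf) [s [a [b [g [h [s12 strict [Em E ga hb]]]]]]].
have s_gt0 : (0 < s)%N by move: s12; rewrite !inE => /orP[]/eqP->.
have s_lt3 : (s < 3)%N by move: s12; rewrite !inE => /orP[]/eqP->.
have [ng nh] : g != 0 /\ h != 0.
  by apply: mul_exp_neq0 s_gt0 _; rewrite -E.
have [x Ex] : exists x : monomle (multideg f), mle x = a.
  by apply: mle_surj; apply/mnm_lepP => j; rewrite Em mnmDE mulmnE; nia.
have [y Ey] : exists y : monomle (multideg f), mle y = b.
  by apply: mle_surj; apply/mnm_lepP => j; rewrite Em mnmDE leq_addl.
exists (Ordinal s_lt3, x, y); first by rewrite /is_split /= Ex Ey s_gt0 strict -Em eqxx.
by exists g, h; rewrite /= Ex Ey.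
Qed.

Lemma nonsingular_dense (l_gt0 : (0 < l)%N) m :
  dense_in_P m (@nonsingular_of_multideg R l m).
Proof.
split=> [f [[nf Em] _]|f fm e e_gt0].
  by apply: multideg_leqm; rewrite Em lepm_refl.
have split_Q (t : split_index m) :
    exists2 Q : {mpoly R[i][#|monomle m|]}, Q != 0 & is_split t ->
      forall g h, g \in leqm (mle t.1.2) -> h \in leqm (mle t.2) -> g != 0 -> h != 0 ->
      Q.@[coef_vector m (g ^+ t.1.1 * h)] = 0.
  have [/and3P[_ /eqP Em strict]|_] := boolP (is_split t); last first.
    by exists 1; rewrite ?oner_neq0.
  by have [Q nQ Q0] := strict_split_vanishing Em strict; exists Q.
have [Q nQ Q0] := fin_all_exists2 split_Q.
pose top : 'I_#|monomle m| := enum_rank (monom (lepm_refl m)).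
have nQtot : 'X_top * \prod_t Q t != 0.
  by rewrite mulf_neq0 //; [rewrite -msupp_eq0 msuppX | apply/prodf_neq0].
have [w Qw] := mpoly_nonvanishing nQtot.
pose W := \sum_(x : monomle m) w (enum_rank x) *: ('X_[mle x] : cpoly R l).
have Wm : W \in leqm m by exact: leqm_expansion.
pose r := e / (coef_norm (W - f) + 1).
have den_gt0 : 0 < coef_norm (W - f) + 1 by rewrite ltr_wpDl ?coef_norm_ge0.
have [|t /andP[t_gt0 t_lt] Qt] := nonvanishing_near (coef_vector m f) Qw (e := r).
  by rewrite divr_gt0.
pose F := f + t%:C%C *: (W - f); have Fm : F \in leqm m.
  by apply: rpredD => //; apply: rpredZ; apply: rpredB.
have {}Qt : ('X_top * \prod_x Q x).@[coef_vector m F] != 0.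
  apply: contraNneq Qt => E; apply/eqP; rewrite -E; apply: meval_eq => j.
  by rewrite /coef_vector /F mcoeffD mcoeffZ mcoeffB mcoeff_expansion enum_valK.
move: Qt; rewrite mevalM mevalXU mulf_eq0 negb_or => /andP[F_top Q_F].
have [nF EF] : has_multideg m F.
  by apply: top_coef_multideg => //; move: F_top; rewrite /coef_vector enum_rankK.
exists F; last first.
  rewrite /F addrC addKr coef_norm_scale //.
  apply: (@le_lt_trans _ _ (t * (coef_norm (W - f) + 1))).
    by rewrite ler_pM2l // lerDl ler01.
  by rewrite -ltr_pdivlMr.
split=> //; apply/(nonsingularP l_gt0 nF); apply: boolp.contrapT => ntriv.
have := nontrivial_split_index l_gt0 nF ntriv; rewrite EF.
case=> x split_x [g [h [E gx hx ng nh]]].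
case/negP: Q_F; rewrite rmorph_prod (bigD1 x) //= mulf_eq0; apply/orP; left.
by rewrite E (Q0 x split_x).
Qed.

End Splittings.

(** * Openness *)

Lemma cross_identity (A : comPzRingType) (a b u v c : A) :
  a * v - b * u = (c * v - b) * u - (c * u - a) * v.
Proof. by ring. Qed.

Section Openness.
Variables (R : realType) (l : nat) (m : 'X_{1..l}).
Implicit Types (f g h : cpoly R l) (a b : 'X_{1..l}).

(** The 2x2 minors of the coefficients of [f] and of a point of the chart have no
    common zero on the compact polydisc, so the sum of their squared moduli is
    bounded below there, while a multiple of that point close to [f] would make
    all of them small. *)
Lemma chart_separated s a b (mu : monomle a) (nu : monomle b) f :
  m = (a *+ s + b)%MM -> f \in leqm m ->
  (forall g h, g \in leqm a -> h \in leqm b -> f <> g ^+ s * h) ->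
  exists2 d : R, 0 < d & forall z (c : R[i]), in_polydisc z ->
    d <= coef_norm (c *: map_mpoly (meval z) (chart R s mu nu) - f).
Proof.
move=> Em fm not_prod.
have Pm z : map_mpoly (meval z) (chart R s mu nu) \in leqm m.
  by rewrite chart_at Em leqmM ?leqmX ?chart_left_leqm ?chart_right_leqm.
have [p PE] : exists p : monomle m -> {mpoly R[i][chart_dim mu nu]}, forall z x,
    (map_mpoly (meval z) (chart R s mu nu))@_(mle x) = (p x).@[z].
  by exists (fun x => (chart R s mu nu)@_(mle x)) => z x; rewrite mcoeff_map_mpoly.
pose q (t : monomle m * monomle m) :=
  f@_(mle t.1) *: p t.2 - f@_(mle t.2) *: p t.1.
have qE t z : (q t).@[z] = f@_(mle t.1) * (p t.2).@[z] - f@_(mle t.2) * (p t.1).@[z].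
  by rewrite /q mevalB !mevalZ.
have no_zero z : in_polydisc z -> exists t, (q t).@[z] != 0.
  move=> _; apply: boolp.contrapT => no; have q0 t : (q t).@[z] = 0.
    by apply/eqP; rewrite -[_ == _]negbK; apply/negP => nz; apply: no; exists t.
  have [y py] : exists y, (p y).@[z] != 0.
    apply: boolp.contrapT => py0; suff /eqP : map_mpoly (meval z) (chart R s mu nu) = 0.
      rewrite chart_at mulf_eq0 expf_eq0 (negbTE (chart_left_neq0 z)) andbF /=.
      by rewrite (negbTE (chart_right_neq0 z)).
    apply: (@leqm_eq R l m) => [||x]; [exact: Pm | exact: rpred0 |].
    rewrite PE mcoeff0; apply/eqP; rewrite -[_ == _]negbK; apply/negP => nz.
    by apply: py0; exists x.
  apply: (not_prod (chart_left z) ((f@_(mle y) / (p y).@[z]) *: chart_right z)).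
  - exact: chart_left_leqm.
  - by apply: rpredZ; exact: chart_right_leqm.
  rewrite -scalerAr -chart_at.
  apply: (@leqm_eq R l m) => [||x]; [exact: fm | by apply: rpredZ; exact: Pm |].
  rewrite mcoeffZ PE mulrAC; apply: (mulIf py); rewrite divfK //.
  by apply/eqP; rewrite -subr_eq0; have := q0 (x, y); rewrite qE /= => ->.
have [c0 c0_gt0 c0_le] := polydisc_lower_bound no_zero.
have [M M_gt0 M_ge] := polydisc_upper_bound p.
(* Each minor at a point of the chart has squared modulus at most [4 M d^2],
   where [d] is the distance to [f]; [N] bounds the sum of them over [d^2]. *)
pose N : R := #|{: monomle m * monomle m}|%:R * (4 * M).
have N_gt0 : 0 < N.
  rewrite mulr_gt0 ?mulr_gt0 ?ltr0n //; apply/card_gt0P.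
  by exists (monom (lepm_refl m), monom (lepm_refl m)).
exists (Num.sqrt (c0 / N)) => [|z c dz]; first by rewrite sqrtr_gt0 divr_gt0.
set g := c *: _; pose d := coef_norm (g - f).
rewrite -(ler_pXn2r (n := 2)) // ?nnegrE ?sqrtr_ge0 ?coef_norm_ge0 //.
rewrite sqr_sqrtr; last by rewrite ltW // divr_gt0.
rewrite ler_pdivrMr //; apply: le_trans (c0_le z dz) _.
have p_le x : sqmod (p x).@[z] <= M.
  apply: le_trans (M_ge z dz); rewrite (bigD1 x) //= lerDl.
  by apply: sumr_ge0 => y _; exact: sqmod_ge0.
have gE x : (g - f)@_(mle x) = c * (p x).@[z] - f@_(mle x).
  by rewrite mcoeffB mcoeffZ PE.
have q_le t : sqmod (q t).@[z] <= d ^+ 2 * (4 * M).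
  have -> : (q t).@[z] = (g - f)@_(mle t.2) * (p t.1).@[z] -
      (g - f)@_(mle t.1) * (p t.2).@[z].
    by rewrite qE !gE; exact: cross_identity.
  apply: le_trans (sqmodB_le _ _) _; rewrite !sqmodM.
  have := sqmod_coef_norm (g - f) (mle t.1); have := sqmod_coef_norm (g - f) (mle t.2).
  have := p_le t.1; have := p_le t.2.
  have := sqmod_ge0 (p t.1).@[z]; have := sqmod_ge0 (p t.2).@[z].
  have := sqmod_ge0 (g - f)@_(mle t.1); have := sqmod_ge0 (g - f)@_(mle t.2).
  rewrite -/d; move: (sqmod _) (sqmod _) (sqmod _) (sqmod _) (d ^+ 2) => u1 u2 v1 v2 w.
  nra.
apply: le_trans (ler_sum _ (fun t _ => q_le t)) _.
by rewrite sumr_const -[_ *+ #|_|]mulr_natl /N mulrCA.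
Qed.

Lemma uniform_radius (T : finType) f (B : T -> cpoly R l -> Prop) :
  (forall t, exists2 d : R, 0 < d & forall g, coef_norm (g - f) < d -> B t g) ->
  exists2 d : R, 0 < d & forall g, coef_norm (g - f) < d -> forall t, B t g.
Proof.
move=> rad; have [d d_gt0 dB] := fin_all_exists2 rad.
exists (\big[Order.min/1]_t d t) => [|g lt t].
  by apply: lt_bigmin => [|t _]; [exact: ltr01 | exact: d_gt0].
apply: dB; apply: lt_le_trans lt _; exact: bigmin_le.
Qed.

Lemma split_separated s a b f : m = (a *+ s + b)%MM -> f \in leqm m ->
  (forall g h, g \in leqm a -> h \in leqm b -> f <> g ^+ s * h) ->
  exists2 d : R, 0 < d & forall F, coef_norm (F - f) < d ->
    forall g h, g \in leqm a -> h \in leqm b -> g != 0 -> h != 0 -> F <> g ^+ s * h.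
Proof.
move=> Em fm not_prod.
pose B (t : monomle a * monomle b) F := forall z (c : R[i]), in_polydisc z ->
  F <> c *: map_mpoly (meval z) (chart R s t.1 t.2).
have [t|d d_gt0 dB] := @uniform_radius _ f B.
  have [d d_gt0 d_le] := chart_separated t.1 t.2 Em fm not_prod.
  by exists d => // F F_near z c dz E; move: F_near; rewrite E ltNge d_le.
exists d => // F /dB BF g h ga hb ng nh E.
have [mu [nu [z [c [dz E']]]]] := @chart_cover R l s a b g h ga hb ng nh.
by apply: (BF (mu, nu) z c dz); rewrite E E'.
Qed.

(** A polynomial close to [f] stays away from all strict splittings, and the
    coefficients that are nonzero in [f] remain nonzero, so the degree cannot
    drop. *)
Lemma nonsingular_open (l_gt0 : (0 < l)%N) :
  open_in_P m (@nonsingular_of_multideg R l m).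
Proof.
split=> [f [[nf Em] _]|f [[nf Em] nsing]].
  by apply: multideg_leqm; rewrite Em lepm_refl.
have fm : f \in leqm m by apply: multideg_leqm; rewrite Em lepm_refl.
have triv_f := (nonsingularP l_gt0 nf).1 nsing.
pose B1 (t : split_index m) (F : cpoly R l) := is_split t ->
  forall g h, g \in leqm (mle t.1.2) -> h \in leqm (mle t.2) -> g != 0 -> h != 0 ->
  F <> g ^+ t.1.1 * h.
pose B2 (x : monomle m) (F : cpoly R l) := f@_(mle x) != 0 -> F@_(mle x) != 0.
have [t|d1 d1_gt0 far] := @uniform_radius _ f B1.
  have [/and3P[s_gt0 /eqP Et strict]|nsplit] := boolP (is_split t); last first.
    by exists 1 => // F _ split_t; rewrite split_t in nsplit.
  have [|d d_gt0 dB] := @split_separated t.1.1 (mle t.1.2) (mle t.2) f Et fm.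
    move=> g h ga hb E; have Emt := Em; rewrite Et in Emt.
    exact: split_nontrivial nf s_gt0 strict Emt E ga hb triv_f.
  by exists d => // F F_near _; exact: dB F_near.
have [x|d2 d2_gt0 near_coef] := @uniform_radius _ f B2.
  have [fx|fx] := boolP (f@_(mle x) == 0); first by exists 1 => // F _; rewrite /B2 fx.
  exists (Num.sqrt (sqmod f@_(mle x))) => [|F].
    by rewrite sqrtr_gt0 lt_def sqmod_eq0 fx sqmod_ge0.
  move=> F_near _; apply: contraTneq F_near => Fx.
  rewrite -leNgt -(ler_pXn2r (n := 2)) // ?nnegrE ?sqrtr_ge0 ?coef_norm_ge0 //.
  rewrite sqr_sqrtr ?sqmod_ge0 //; apply: le_trans (sqmod_coef_norm _ (mle x)).
  by rewrite mcoeffB Fx sub0r /sqmod; case: (f@_(mle x)) => u v /=; rewrite !sqrrN.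
exists (Num.min d1 d2) => [|F Fm]; first by rewrite lt_min d1_gt0.
rewrite lt_min => /andP[/far F_far /near_coef F_coef].
have supp_sub mu : mu \in msupp f -> mu \in msupp F.
  move=> mu_f; have [x Ex] : exists x : monomle m, mle x = mu.
    by apply: mle_surj; rewrite -Em; exact: multideg_ge.
  by rewrite mcoeff_msupp -Ex; apply: F_coef; rewrite Ex -mcoeff_msupp.
have nF : F != 0.
  have /supp_sub := mlead_supp nf; rewrite mcoeff_msupp.
  by apply: contraNneq => ->; rewrite mcoeff0.
have EF : multideg F = m.
  apply: multideg_squeeze => //; apply/mnm_lepP => i.
  have [mu mu_f] := multideg_attained i nf; rewrite Em => <-.
  exact: (mnm_lepP (multideg_ge (supp_sub _ mu_f)) i).
split=> //; apply/(nonsingularP l_gt0 nF); apply: boolp.contrapT => ntriv.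
have := nontrivial_split_index l_gt0 nF ntriv; rewrite EF.
case=> t split_t [g [h [E ga hb ng nh]]].
exact: F_far t split_t g h ga hb ng nh E.
Qed.

End Openness.

Theorem corollary3p7 (R : realType) (l : nat) (hl : (0 < l)%N) :
  (forall (f : cpoly R l) (M : fstructure l),
     has_fstructure f M -> (singular f <-> nontrivial_fstructure R M)) /\
  (forall m : multidegree l,
     open_in_P m (@nonsingular_of_multideg R l m) /\
     dense_in_P m (@nonsingular_of_multideg R l m)).
Proof.
split=> [f M|m]; first exact: singular_nontrivial.
by split; [exact: nonsingular_open | exact: nonsingular_dense].
Qed.
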